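(* For every $\tau\in(0,\infty]$ and $0<\delta<1-\frac{1}{1+\tau}$ there exists a topological dynamical system $(X,f)$ satisfying the non-uniform $\tau$-specification property with gap function $M(n,\varepsilon)$ such that: (1) for all sufficiently small $\varepsilon>0$, $\lim_{n\to\infty}\frac{M(n,\varepsilon)}{n}=\tau$; (2) there is $\psi\in\mathfrak{C}(f)$ with $h_{top}^B(f,I_\psi(f))=h_{top}(f)$, and consequently $h_{top}^B(f,\mathrm{IR}(f))=h_{top}(f)$; (3) there is $\varphi\in\mathfrak{C}(f)$ with $$h_{top}^B(f,I_\varphi(f))\le\Big(\frac{1}{1+\tau}+\delta\Big)h_{top}(f)<h_{top}(f),$$ and consequently $$h_{top}^B(f,\mathrm{CI}(f))\le\Big(\frac{1}{1+\tau}+\delta\Big)h_{top}(f)<h_{top}(f).$$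
   Context: Convention: $\frac1{1+\infty}=0$. A topological dynamical system $(X,f)$ consists of a compact metric space $(X,d)$ with at least two points and a continuous map $f:X\to X$. $C(X)$ is the space of real continuous functions on $X$; $h_{top}(f)$ is topological entropy. Non-uniform specification: $(X,f)$ has the non-uniform specification property with gap function $M:\mathbb{N}\times(0,\infty)\to\mathbb{N}$ ($\mathbb{N}$ the positive integers) if $M(n,\varepsilon)$ is non-decreasing in $n$ and non-increasing in $\varepsilon$, and for every $\varepsilon>0$, every integer $k\ge2$, all $x_1,\dots,x_k\in X$ and all non-negative integers $a_1\le b_1<a_2\le b_2<\cdots<a_k\le b_k$ with $a_{i+1}-b_i\ge M(b_i-a_i+1,\varepsilon)$ for $1\le i\le k-1$, there is $z\in X$ with $d(f^{n-a_i}x_i,f^nz)\le\varepsilon$ for all $a_i\le n\le b_i$, $1\le i\le k$. Let $\mathscr{G}(X,f)$ be the set of all such gap functions for $(X,f)$ and $\tau(M)=\sup_{\varepsilon>0}\liminf_{n\to\infty}M(n,\varepsilon)/n\in[0,\infty]$. $(X,f)$ has the non-uniform $\tau$-specification property if there is $M\in\mathscr{G}(X,f)$ with $\tau(M)=\tau$ and every $M'\in\mathscr{G}(X,f)$ satisfies $\tau(M')\ge\tau$; ''with gap function $M$'' means $M\in\mathscr{G}(X,f)$. Irregular sets: for $\varphi\in C(X)$, $I_\varphi(f)=\{x\in X:\lim_{n\to\infty}\frac1n\sum_{k=0}^{n-1}\varphi(f^kx)\text{ does not exist}\}$; $\mathfrak{C}(f)=\{\varphi\in C(X):I_\varphi(f)\ne\varnothing\}$;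 $\mathrm{IR}(f)=\bigcup_{\varphi\in C(X)}I_\varphi(f)$; $\mathrm{CI}(f)=\bigcap_{\varphi\in\mathfrak{C}(f)}I_\varphi(f)$. Bowen topological entropy of $F\subset X$: let $B_n(x,\varepsilon)=\{y:\max_{0\le i\le n-1}d(f^ix,f^iy)<\varepsilon\}$. For $t\ge0$ let $C(F;t,N,\varepsilon,f)$ be the infimum of $\sum_k e^{-tn_k}$ over finite or countable covers $\{B_{n_k}(x_k,\varepsilon)\}$ of $F$ with $x_k\in F$, $n_k\ge N$; let $C(F;t,\varepsilon,f)=\lim_{N\to\infty}C(F;t,N,\varepsilon,f)$, $h_{top}^B(F;\varepsilon,f)=\inf\{t\ge0:C(F;t,\varepsilon,f)=0\}$ and $h_{top}^B(f,F)=\lim_{\varepsilon\to0}h_{top}^B(F;\varepsilon,f)$. *)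

(* Defs.v *)
(* MathComp-Analysis *)
From HB Require Import structures.
From mathcomp Require Import all_boot all_order all_algebra finmap.
From mathcomp Require Import all_classical all_reals all_analysis.

Set Implicit Arguments.
Unset Strict Implicit.
Unset Printing Implicit Defensive.

Import Order.TTheory GRing.Theory Num.Theory.
Import numFieldTopology.Exports numFieldNormedType.Exports.

Local Open Scope classical_set_scope.
Local Open Scope ring_scope.

Section dynamics.
Context {R : realType} {X : metricType R}.
Implicit Types (f : X -> X) (M : nat -> R -> nat) (phi : X -> R) (F : set X).

Definition is_tds f : Prop :=
  [/\ compact [set: X], exists x y : X, x != y & continuous f].

(** ** Non-uniform specification *)

(* Only the values [M n eps] with [0 < n] and [0 < eps] are meaningful, so
   positivity and monotonicity are imposed there only.  The family of orbit
   segments is indexed from 0, and by [b i < a i.+1] the subtractions are not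
   truncated. *)
Definition gap_function f M : Prop :=
  [/\ forall n (eps : R), (0 < n)%N -> 0 < eps -> (0 < M n eps)%N,
      forall m n (eps : R), (0 < m)%N -> (m <= n)%N -> 0 < eps ->
        (M m eps <= M n eps)%N,
      forall n (eps eps' : R), (0 < n)%N -> 0 < eps -> eps <= eps' ->
        (M n eps' <= M n eps)%N &
      forall (eps : R) (k : nat) (x : nat -> X) (a b : nat -> nat),
        0 < eps -> (2 <= k)%N ->
        (forall i, (i < k)%N -> (a i <= b i)%N) ->
        (forall i, (i.+1 < k)%N -> (b i < a i.+1)%N) ->
        (forall i, (i.+1 < k)%N -> (M (b i - a i + 1) eps <= a i.+1 - b i)%N) ->
        exists z : X, forall i n, (i < k)%N -> (a i <= n <= b i)%N ->
          mdist (iter (n - a i) f (x i)) (iter n f z) <= eps].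

(* At [n = 0] the quotient is [0] by the convention [0^-1 = 0]. *)
Definition gap_ratio M (eps : R) (n : nat) : \bar R :=
  ((M n eps)%:R / n%:R)%:E.

Definition gap_tau M : \bar R :=
  ereal_sup [set limn_einf (gap_ratio M eps) | eps in [set e : R | 0 < e]].

Definition nonuniform_tau_specification f (tau : \bar R) : Prop :=
  exists M, [/\ gap_function f M, gap_tau M = tau &
    forall M', gap_function f M' -> (tau <= gap_tau M')%E].

(** ** Irregular sets *)

Definition birkhoff_average f phi (x : X) (n : nat) : R :=
  n%:R^-1 * \sum_(k < n) phi (iter k f x).

Definition irregular_set f phi : set X :=
  [set x | ~ cvgn (birkhoff_average f phi x)].

Definition irregular_observables f : set (X -> R) :=
  [set phi | continuous phi /\ irregular_set f phi !=set0].

Definition IR f : set X :=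
  \bigcup_(phi in [set phi : X -> R | continuous phi]) irregular_set f phi.

Definition CI f : set X :=
  \bigcap_(phi in irregular_observables f) irregular_set f phi.

(** ** Entropy *)

Definition bowen_dist f (n : nat) (x y : X) : R :=
  \big[Num.max/0]_(i < n) mdist (iter i f x) (iter i f y).

Definition bowen_ball f (n : nat) (x : X) (eps : R) : set X :=
  [set y | bowen_dist f n x y < eps].

Definition bowen_separated f (n : nat) (eps : R) (E : {fset X}) : Prop :=
  forall x y, x \in E -> y \in E -> x != y -> eps < bowen_dist f n x y.

Definition sep_number f (n : nat) (eps : R) : \bar R :=
  ereal_sup [set (#|` E|%fset)%:R%:E | E in bowen_separated f n eps].

(* Topological entropy in the Bowen-Dinaburg form. *)
Definition htop_scale f (eps : R) : \bar R :=
  limn_esup (fun n => (n%:R^-1)%:E * lne (sep_number f n eps))%E.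

Definition htop f : \bar R := lim (htop_scale f eps @[eps --> 0^'+]).

(* The values of [\sum_k e^(- t n_k)] over the finite or countable covers of
   [F] by Bowen balls; such a cover is indexed by a set [D] of naturals. *)
Definition cover_sums f F (t : R) (N : nat) (eps : R) : set (\bar R) :=
  [set s | exists (D : set nat) (c : nat -> X) (m : nat -> nat),
    [/\ forall k, D k -> F (c k) /\ (N <= m k)%N,
        F `<=` \bigcup_(k in D) bowen_ball f (m k) (c k) eps &
        s = \esum_(k in D) (expR (- (t * (m k)%:R)))%:E]].

Definition bowen_outer_at f F (t : R) (N : nat) (eps : R) : \bar R :=
  ereal_inf (cover_sums f F t N eps).

Definition bowen_outer f F (t eps : R) : \bar R :=
  limn (fun N => bowen_outer_at f F t N eps).

Definition bowen_entropy_scale f F (eps : R) : \bar R :=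
  ereal_inf [set t%:E | t in [set t : R | 0 <= t /\ bowen_outer f F t eps = 0%E]].

Definition bowen_entropy f F : \bar R :=
  lim (bowen_entropy_scale f F eps @[eps --> 0^'+]).

End dynamics.

(* Main.v *)
(* The space is a one-sided subshift over 0, 1, ..., m + 2: a zero-free run of
   length r that is followed by a 0 must be followed by at least g r zeros,
   where g r / r tends to tau.  Since g n zeros allow any word of length n to be
   followed by any other word, while n copies of m + 2 followed by the word
   0 (m + 2) need that large a gap, the optimal gap ratio is tau.
   Zero-free sequences form a full shift on H = m + 2 symbols, which carries the
   whole entropy log H.  A point whose frequency of zeros does not converge
   meets 0 infinitely often, hence is a concatenation of blocks "0" and
   "u 0^(g r)" with u zero-free of length r; once H is large, these blocks
   satisfy a Kraft inequality at the exponent c log H, where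
   c = 1 / (1 + tau) + delta, so such points have entropy at most c log H.
   To see that irregular points may have full entropy, fix a large length l and
   the most frequent number of 1s among the zero-free words of length l.
   Concatenating freely the words with that number of 1s, each followed by a
   marker 1 or m + 2 chosen so that the frequency of 1s diverges, leaves entropy
   at least (l log H - log (l + 1)) / (l + 1). *)

Require Import Defs.
From HB Require Import structures.
From mathcomp Require Import all_boot all_order all_algebra finmap.
From mathcomp Require Import all_classical all_reals all_analysis.
From mathcomp Require Import zify ring lra.

Import Order.TTheory GRing.Theory Num.Theory.
Import numFieldTopology.Exports numFieldNormedType.Exports.

Local Open Scope classical_set_scope.
Local Open Scope ring_scope.

Set Implicit Arguments.
Unset Strict Implicit.
Unset Printing Implicit Defensive.

(** * The subshift and its metric *)

(** The window before the 0 may be any zero-free one: for monotone [g] the maximal run makes the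
    strongest demand. The zero at [p + r] counts among the [g r] compulsory ones. Each instance
    bears on finitely many coordinates, so the condition is closed. *)
Definition allowed (m : nat) (g : nat -> nat) (x : nat -> 'I_m.+3) : Prop :=
  forall p r l, (forall i, (i < r)%N -> x (p + i)%N != ord0) ->
    x (p + r)%N = ord0 -> (l < g r)%N -> x (p + r + l)%N = ord0.

Definition gap_shift (R : realType) (m : nat) (g : nat -> nat) : Type :=
  {x : nat -> 'I_m.+3 | allowed g x}.

Section gap_shift_metric.
Context {R : realType} {m : nat} {g : nat -> nat}.
Local Notation X := (gap_shift R m g).
Implicit Types x y z : X.

HB.instance Definition _ := gen_eqMixin X.
HB.instance Definition _ := gen_choiceMixin X.

Definition agree n x y := forall i, (i < n)%N -> sval x i = sval y i.

(** With this normalisation two points with different first symbols are at distance 1, so every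
    scale below 1 reads the first symbol exactly. *)
Definition first_diff_dist x y : R :=
  if pselect (exists n, sval x n != sval y n) is left e
  then (ex_minn e).+1%:R^-1 else 0.

Lemma first_diff_dist_ge x y k : sval x k != sval y k ->
  k.+1%:R^-1 <= first_diff_dist x y.
Proof.
rewrite /first_diff_dist => xyk; case: pselect => [e|[]]; last by exists k.
case: ex_minnP => n _ /(_ _ xyk) nk.
by rewrite lef_pV2 ?posrE// ler_nat ltnS.
Qed.

Lemma first_diff_dist_lt x y n :
  first_diff_dist x y < n.+1%:R^-1 <-> agree n.+1 x y.
Proof.
split=> [xyn i|xyn].
  rewrite ltnS => lein; apply/eqP; apply: contraTT xyn => /first_diff_dist_ge.
  rewrite -leNgt; apply: le_trans.
  by rewrite lef_pV2 ?posrE// ler_nat ltnS.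
rewrite /first_diff_dist; case: pselect => [e|_]; last by rewrite invr_gt0.
case: ex_minnP => k xyk _; rewrite ltf_pV2 ?posrE// ltr_nat ltnS ltnNge.
by apply: contra xyk => kn; rewrite xyn.
Qed.

Lemma first_diff_distxx x : first_diff_dist x x = 0.
Proof.
by rewrite /first_diff_dist; case: pselect => // e; exfalso; case: e => n /eqP.
Qed.

Lemma first_diff_dist_ge0 x y : 0 <= first_diff_dist x y.
Proof.
by rewrite /first_diff_dist; case: pselect => // e; rewrite invr_ge0.
Qed.

Lemma gap_shift_eq x y : sval x =1 sval y -> x = y.
Proof. by case: x y => [x xP] [y yP] /= /funext xy; apply: eq_exist. Qed.

Lemma first_diff_dist_positivity x y : first_diff_dist x y = 0 -> x = y.
Proof.
move=> xy0; apply: gap_shift_eq => i; apply/eqP.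
apply: contra_eqT xy0 => /first_diff_dist_ge xyi.
by rewrite gt_eqF// (lt_le_trans _ xyi)// invr_gt0.
Qed.

Lemma first_diff_dist_sym x y : first_diff_dist x y = first_diff_dist y x.
Proof.
wlog suff: x y / first_diff_dist x y <= first_diff_dist y x.
  by move=> H; apply/le_anti; rewrite !H.
rewrite {1}/first_diff_dist; case: pselect => [e|_]; last first.
  exact: first_diff_dist_ge0.
by case: ex_minnP => k xyk _; apply: first_diff_dist_ge; rewrite eq_sym.
Qed.

(** Where [x] and [z] first differ, [y] differs from one of them, and the distance to that one alone
    is large enough. *)
Lemma first_diff_dist_triangle y x z :
  first_diff_dist x z <= first_diff_dist x y + first_diff_dist y z.
Proof.
rewrite {1}/first_diff_dist; case: pselect => [e|_]; last first.
  by rewrite addr_ge0 ?first_diff_dist_ge0.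
case: ex_minnP => k xzk _.
have [xyk|/first_diff_dist_ge xyk] := eqVneq (sval x k) (sval y k).
  by apply: ler_wpDl (first_diff_dist_ge0 _ _) (first_diff_dist_ge _); rewrite -xyk.
exact: ler_wpDr (first_diff_dist_ge0 _ _) xyk.
Qed.

HB.instance Definition _ := isMetric.Build R X first_diff_distxx
  first_diff_dist_positivity first_diff_dist_sym first_diff_dist_triangle.

Lemma mdist_lt x y n : mdist x y < n.+1%:R^-1 <-> agree n.+1 x y.
Proof. exact: first_diff_dist_lt. Qed.

Lemma nbhs_agree x (A : set X) n :
  (forall y, agree n x y -> A y) -> nbhs x A.
Proof.
move=> nA; apply: (@filterS _ _ _ (ball x n.+1%:R^-1)); last first.
  by apply: nbhsx_ballx; rewrite invr_gt0.
move=> y; rewrite ballEmdist /= => /mdist_lt xy; apply: nA => i ni.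
exact/xy/ltnW.
Qed.

Lemma nbhs_agreeP x (A : set X) :
  nbhs x A <-> exists n, forall y, agree n x y -> A y.
Proof.
split=> [|[n nA]]; last exact: nbhs_agree nA.
rewrite -nbhs_ballE => -[e /= e0 eA]; exists (Num.truncn e^-1).+1 => y.
move=> /mdist_lt xy; apply: eA; rewrite ballEmdist /=.
apply: lt_trans xy _.
by rewrite -[ltRHS]invrK ltf_pV2 ?posrE ?invr_gt0// truncnS_gt.
Qed.

(** The alphabet is finite, so an ultrafilter selects one symbol at each coordinate. The resulting
    sequence agrees on any finite window with a point of the space, hence is itself allowed. *)
Lemma gap_shift_compact : compact [set: X].
Proof.
rewrite compact_ultra => F UF _.
have symb n : exists s, F [set x | sval x n = s].
  apply: contrapT => /forallNP nF.
  have : F [set x | forall s, sval x n <> s].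
    apply: filter_forall => s.
    by have [/nF//|] := in_ultra_setVsetC [set x | sval x n = s] UF.
  by move=> /filter_ex[x /(_ (sval x n))].
have [y Fy] := choice symb.
have Fagree n : F [set x : X | forall i, (i < n)%N -> sval x i = y i].
  elim: n => [|n IH]; first by apply: filterE => x i.
  apply: filterS2 IH (Fy n) => x xn /= xyn i.
  by rewrite ltnS leq_eqVlt => /predU1P[->//|/xn].
have yP : allowed g y.
  move=> p r l yr yp lg.
  have [x /= xy] := filter_ex (Fagree (p + r + l).+1).
  rewrite -xy//; apply: (svalP x) => [i ir||//]; last by rewrite xy//; lia.
  by rewrite xy ?yr//; lia.
exists (exist _ y yP); split=> // A /nbhs_agreeP[n nA].
by apply: filterS (Fagree n) => x xy; apply: nA => i /xy ->.
Qed.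

End gap_shift_metric.

(** * Specification *)

Lemma le_limn_esup {R : realType} (u v : (\bar R)^nat) :
  (\forall n \near \oo, (u n <= v n)%E) -> (limn_esup u <= limn_esup v)%E.
Proof.
move=> uv; apply: le_ereal_inf_tmp => _ [V FV <-].
apply: ge_ereal_inf; exists (ereal_sup (u @` (V `&` [set n | (u n <= v n)%E]))).
  by exists (V `&` [set n | (u n <= v n)%E]) => //; exact: filterI.
apply: ge_ereal_sup => _ [n [Vn unvn] <-].
by apply: le_trans unvn _; apply: ereal_sup_ubound; exists n.
Qed.

Lemma le_limn_einf {R : realType} (u v : (\bar R)^nat) :
  (\forall n \near \oo, (u n <= v n)%E) -> (limn_einf u <= limn_einf v)%E.
Proof.
move=> uv; rewrite -leeN2 -!limn_esupN; apply: le_limn_esup.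
by apply: filterS uv => n /=; rewrite leeN2.
Qed.

Section specification.
Context {R : realType} {m : nat} {g : nat -> nat}.
Hypotheses (g_mono : {homo g : r s / (r <= s)%N}) (g0 : g 0%N = 0%N)
  (g_gt0 : forall r, (0 < r)%N -> (0 < g r)%N).
Local Notation X := (gap_shift R m g).

Lemma allowed_shift (x : X) : allowed g (fun n => sval x n.+1).
Proof. by move=> p; apply: (svalP x p.+1). Qed.

Definition shift (x : X) : X := exist _ _ (@allowed_shift x).

Lemma iter_shift n (x : X) i : sval (iter n shift x) i = sval x (n + i)%N.
Proof. by elim: n i => //= n IH i; rewrite IH addnS addSn. Qed.

Lemma allowed_nonzero (x : nat -> 'I_m.+3) :
  (forall n, x n != ord0) -> allowed g x.
Proof. by move=> x0 p r l _ /eqP; rewrite (negPf (x0 _)). Qed.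

Lemma allowed_zero_nonzero (x : nat -> 'I_m.+3) :
  (forall n, x n.+1 != ord0) -> allowed g x.
Proof.
move=> x0 p r l _; case: (p + r)%N (leq_addl p r) => [|n _ /eqP].
  by rewrite leqn0 => /eqP -> _; rewrite g0.
by rewrite (negPf (x0 _)).
Qed.

Lemma allowed_zero : allowed g (fun=> ord0 : 'I_m.+3).
Proof. by []. Qed.

Definition zero_point : X := exist _ _ (@allowed_zero).

Lemma nonzero_ord_max : (ord_max : 'I_m.+3) != ord0.
Proof. by []. Qed.

Definition max_point : X :=
  exist _ _ (@allowed_nonzero _ (fun=> nonzero_ord_max)).

Definition zero_max_point : X :=
  exist _ (fun n => if n == 0%N then ord0 else ord_max)
    (@allowed_zero_nonzero _ (fun=> nonzero_ord_max)).

Lemma continuous_shift : continuous shift.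
Proof.
move=> x A /nbhs_agreeP[n nA]; apply: (@nbhs_agree _ _ _ _ _ n.+1) => y xy.
by apply: nA => i ni; apply: xy.
Qed.

Lemma shift_is_tds : is_tds shift.
Proof.
split; [exact: gap_shift_compact| |exact: continuous_shift].
by exists zero_point, max_point; apply/eqP => /(congr1 (fun x => sval x 0%N)).
Qed.

(** The word from [x] is moved to start at [a], whereas [z] stays in place from [b] on; segments
    already placed in [z] thus keep their positions. *)
Definition glue (a e b : nat) (x z : nat -> 'I_m.+3) n :=
  if (n < a)%N then ord0 else if (n < e)%N then x (n - a)%N
  else if (n < b)%N then ord0 else z n.

(** A zero-free window lies either within the copy of [x], of length [e - a], or beyond [b]. In the
    first case the zeros it requires come from [x] up to [e], and then from the gap, which has room
    for [g (e - a)] of them. *)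
Lemma allowed_glue a e b x z : allowed g x -> allowed g z ->
  (a <= e)%N -> (e < b)%N -> (e + g (e - a) <= b)%N ->
  allowed g (glue a e b x z).
Proof.
move=> xg zg ae eb egb p [|r] l pr; first by rewrite g0.
move: (pr 0%N isT); rewrite {1}/glue addn0.
case: ifPn => // ap; rewrite -leqNgt in ap.
case: ifPn => [pe _|].
  (* The window cannot cross [e], since [e < b] puts a 0 there. *)
  have re : (p + r < e)%N.
    rewrite ltnNge; apply/negP => epr; have := pr (e - p)%N.
    rewrite /glue subnKC ?(ltnW pe)// ltnn eb (ltnNge e a) ae/=.
    by move=> pre; suff: false by []; apply: pre; lia.
  have gr : (g r.+1 <= g (e - a))%N by apply: g_mono; lia.
  move=> prl lg; rewrite /glue; case: ifPn => // apl.
  case: ifPn => [ple|eple]; last by rewrite ifT//; lia.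
  have -> : (p + r.+1 + l - a = p - a + r.+1 + l)%N by lia.
  apply: xg lg => [i ir|]; last first.
    have -> : (p - a + r.+1 = p + r.+1 - a)%N by lia.
    by move: prl; rewrite /glue ifF ?ifT//; lia.
  have -> : (p - a + i = p + i - a)%N by lia.
  by have := pr i ir; rewrite /glue ifF ?ifT//; lia.
rewrite -leqNgt => ep; case: ifPn => // bp _.
have glueE n : (p <= n)%N -> glue a e b x z n = z n.
  by move=> pn; rewrite /glue !ifF//; lia.
rewrite !glueE; [|lia..] => prl; apply: zg prl => i ir.
by rewrite -(glueE (p + i)%N) ?pr//; lia.
Qed.

Lemma glue_segments k (x : nat -> X) (a e : nat -> nat) :
  (forall i, (i <= k)%N -> (a i <= e i)%N) ->
  (forall i, (i < k)%N -> (e i < a i.+1)%N) ->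
  (forall i, (i < k)%N -> (e i + g (e i - a i) <= a i.+1)%N) ->
  exists z : X, forall i n, (i <= k)%N -> (a i <= n < e i)%N ->
    sval z n = sval (x i) (n - a i)%N.
Proof.
elim: k x a e => [|k IH] x a e ae ea ega.
  (* After the last segment only zeros follow; the successor makes the gap nonempty even if [g]
     vanishes on the length of the segment. *)
  have ok : allowed g (glue (a 0%N) (e 0%N) (e 0%N + g (e 0%N - a 0%N)).+1%N
      (sval (x 0%N)) (sval zero_point)).
    by apply: allowed_glue; [exact: svalP|exact: svalP|exact: ae|lia|lia].
  exists (exist _ _ ok) => i n; rewrite leqn0 => /eqP -> /andP[an ne] /=.
  by rewrite /glue ifF ?ifT//; lia.
have [z zP] := IH (x \o succn) (a \o succn) (e \o succn)
  (fun i => ae i.+1) (fun i => ea i.+1) (fun i => ega i.+1).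
have ok : allowed g (glue (a 0%N) (e 0%N) (a 1%N) (sval (x 0%N)) (sval z)).
  by apply: allowed_glue;
    [exact: svalP|exact: svalP|exact: ae|exact: ea|exact: ega].
exists (exist _ _ ok) => -[|i] n ik /andP[an ne] /=.
  by rewrite /glue ifF ?ifT//; lia.
have ain : (a 1%N <= a i.+1)%N.
  elim: i ik {an ne} => // i IHi ik; apply: leq_trans (IHi (ltnW ik)) _.
  by apply: leq_trans (ae i.+1 (ltnW ik)) (ltnW (ea i.+1 ik)).
have := ae 0%N isT; have := ea 0%N isT => ea0 ae0.
by rewrite /glue !ifF; [apply: zP => //; rewrite an|lia..].
Qed.

Definition depth (eps : R) : nat := Num.truncn eps^-1.

Lemma agree_mdist_lt (eps : R) (x y : X) : 0 < eps ->
  agree (depth eps).+1 x y -> mdist x y < eps.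
Proof.
move=> e0 /mdist_lt xy; apply: lt_trans xy _.
by rewrite -[ltRHS]invrK ltf_pV2 ?posrE ?invr_gt0// truncnS_gt.
Qed.

(** To follow [n] iterates up to [eps], [n + depth eps] symbols are prescribed, and these call for
    [g (n + depth eps)] zeros. The distance is measured from the last time of the segment, whereas
    its symbols extend [depth eps] further: hence the added [depth eps] and the successor. *)
Definition gap (n : nat) (eps : R) : nat :=
  ((g (n + depth eps) + depth eps).+1)%N.

Lemma gap_function_gap : gap_function shift gap.
Proof.
split => [//|r s eps _ rs _|n e1 e2 n0 e1_gt0 e12|eps k x a b e0 k2 ab ba Mba].
- by rewrite ltnS leq_add2r g_mono// leq_add2r.
- have e21 : (depth e2 <= depth e1)%N.
    by apply: le_truncn; rewrite lef_pV2 ?posrE// (lt_le_trans e1_gt0).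
  by rewrite ltnS leq_add// g_mono// leq_add2l.
have [|i ik|i ik|z zP] := @glue_segments k.-1 x a (fun i => (b i + depth eps).+1).
- by move=> i ik; have := ab i; lia.
- have := @g_gt0 (b i - a i + 1 + depth eps)%N; have := Mba i.
  by rewrite /gap; lia.
- have := Mba i; rewrite /gap; have := ab i; have := ba i => h1 h2.
  have -> : ((b i + depth eps).+1 - a i = b i - a i + 1 + depth eps)%N by lia.
  by lia.
exists z => i n ik /andP[an nb]; apply/ltW/agree_mdist_lt => // j jL.
rewrite !iter_shift (zP i); [congr (sval _ _)| |]; lia.
Qed.

(** At scale 1/2 the shadowing point copies symbols exactly: it starts with [n] nonzero symbols, and
    later shows a 0 followed at once by a nonzero symbol. Its first zero [p >= n] ends a run of
    length [p], so [g p >= g n] zeros must fit before that nonzero symbol. *)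
Lemma gap_function_ge M n : gap_function shift M -> (0 < n)%N ->
  (g n <= M n (2%:R^-1 : R))%N.
Proof.
move=> [M0 _ _ Mspec] n0; set e : R := 2%:R^-1.
have e0 : 0 < e by rewrite invr_gt0.
have Mn0 := M0 n e n0 e0.
(* The second segment starts exactly [M n e] after the end [n.-1] of the first, the least distance
   that specification admits. *)
pose a i := (if i == 0 then 0 else n.-1 + M n e)%N.
pose b i := (if i == 0 then n.-1 else n + M n e)%N.
have [|||z zP] := Mspec e 2%N
    (fun i => if i == 0%N then max_point else zero_max_point) a b e0 isT.
- by move=> [|[|]]//=; rewrite /a /b/=; lia.
- by move=> [|[|]]//=; rewrite /a /b/=; lia.
- move=> [|[|]]//= _; rewrite /a /b/= subn0 addn1 prednK//; lia.
have eq0 (x y : X) : mdist x y <= e -> sval x 0%N = sval y 0%N.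
  move=> xy; apply: ((mdist_lt x y 0).1 _) => //.
  by apply: le_lt_trans xy _; rewrite invr1 invf_lt1// ltr1n.
have z1 i : (i < n)%N -> sval z i != ord0.
  move=> iN; have := zP 0%N i isT; rewrite /a /b/= => /(_ _)/eq0.
  by rewrite !iter_shift !addn0 => <-//; lia.
have za : sval z (n.-1 + M n e)%N = ord0.
  have := zP 1%N (n.-1 + M n e)%N isT; rewrite /a /b/= subnn => /(_ _)/eq0.
  by rewrite !iter_shift !addn0 => <-//; lia.
have zb : sval z (n + M n e)%N != ord0.
  have := zP 1%N (n + M n e)%N isT; rewrite /a /b/= => /(_ _)/eq0.
  rewrite !iter_shift !addn0 => <-//; last by lia.
  by have -> : (n + M n e - (n.-1 + M n e) = 1)%N by lia.
have ex : exists p, sval z p == ord0 by exists (n.-1 + M n e)%N; apply/eqP.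
case: (ex_minnP ex) => p /eqP zp pmin.
have np : (n <= p)%N by rewrite leqNgt; apply/negP => /z1; rewrite zp eqxx.
have pM : (p <= n.-1 + M n e)%N by apply: pmin; rewrite za.
apply: leq_trans (g_mono np) _; rewrite leqNgt; apply/negP => Mg.
move/eqP: zb; apply; have -> : (n + M n e = 0 + p + (n + M n e - p))%N by lia.
apply: (svalP z) => // [i ip|]; last by lia.
by rewrite add0n; apply/negP => /pmin; rewrite leqNgt ip.
Qed.

(** * Asymptotic gap ratio and its optimality *)

Variable tau : \bar R.
Hypotheses (tau_gt0 : (0 < tau)%E)
  (g_cvg : ((g n)%:R / n%:R)%:E @[n --> \oo] --> tau).

Lemma cvg_gap_ratio eps : gap_ratio gap eps @ \oo --> tau.
Proof.
set L := depth eps.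
(* The ratio [gap n eps / n] equals [g (n + L) / (n + L)] times [u n], plus [v n], where [u] tends
   to 1 and [v] to 0. *)
pose u n : R := (n + L)%N%:R / n%:R; pose v n : R := L.+1%:R / n%:R.
have ncvg (c : R) : c / n%:R @[n --> \oo] --> (0 : R).
  rewrite -(mulr0 c); apply: cvgM; first exact: cvg_cst.
  by rewrite -cvg_shiftS; exact: cvg_harmonic.
have ucvg : (u n)%:E @[n --> \oo] --> 1%E.
  apply: cvg_EFin; first by near=> n.
  have : (1 + L%:R / n%:R : R) @[n --> \oo] --> (1 + 0 : R).
    by apply: cvgD; [exact: cvg_cst|exact: ncvg].
  rewrite addr0; apply: cvg_trans; apply: near_eq_cvg; near=> n.
  rewrite /= /u natrD mulrDl divff//.
  by rewrite pnatr_eq0 -lt0n; near: n; exists 1%N.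
have vcvg : (v n)%:E @[n --> \oo] --> 0%E.
  by apply: cvg_EFin; [near=> n|exact: ncvg].
have gcvg : ((g (n + L)%N)%:R / (n + L)%N%:R)%:E @[n --> \oo] --> tau.
  by have := g_cvg; rewrite -(cvg_shiftn L).
(* These two facts make the product and the sum of the limits meaningful for infinite [tau] as
   well. *)
have tau1 : (tau *? 1%E)%E by rewrite neq0_mule_def// mule1 gt_eqF.
have tau0 : (tau * 1 +? 0)%E by rewrite mule1 fin_num_adde_defl.
have : (((g (n + L)%N)%:R / (n + L)%N%:R)%:E * (u n)%:E + (v n)%:E)%E
    @[n --> \oo] --> (tau * 1 + 0)%E.
  exact: cvgeD tau0 (cvgeM tau1 gcvg ucvg) vcvg.
rewrite mule1 adde0; apply: cvg_trans; apply: near_eq_cvg; near=> n.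
have n0 : (0 < n)%N by near: n; exists 1%N.
rewrite /gap_ratio /gap -/L -EFinM -EFinD /u /v mulrA divfK; last first.
  by rewrite pnatr_eq0; lia.
by rewrite -mulrDl -natrD addnS.
Unshelve. all: by end_near. Qed.

Lemma gap_tau_gap : gap_tau gap = tau.
Proof.
have limE eps : limn_einf (gap_ratio gap eps) = tau.
  by have [] := cvg_limn_einf_sup (cvg_gap_ratio eps).
rewrite /gap_tau; under eq_imagel do rewrite limE.
suff -> : [set tau | _ in [set e : R | 0 < e]] = [set tau] by rewrite ereal_sup1.
by apply/seteqP; split=> [_ [e _ <-]//|_ ->]; exists 1 => //=.
Qed.

Lemma gap_tau_ge M : gap_function shift M -> (tau <= gap_tau M)%E.
Proof.
move=> Mgap; apply: le_trans (ereal_sup_ubound _); last first.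
  by exists (2%:R^-1 : R) => //=; rewrite invr_gt0.
have [<- _] := cvg_limn_einf_sup g_cvg; apply: le_limn_einf.
near=> n; rewrite /gap_ratio lee_fin ler_wpM2r// ler_nat.
apply: gap_function_ge => //; near: n; by exists 1%N.
Unshelve. all: by end_near. Qed.

Lemma shift_tau_specification : nonuniform_tau_specification shift tau.
Proof.
exists gap; split; [exact: gap_function_gap|exact: gap_tau_gap|].
exact: gap_tau_ge.
Qed.

End specification.

(** * Words *)

Section words.
Context {m : nat} {g : nat -> nat}.
Local Notation symbol := 'I_m.+3.
Implicit Types (w u : seq symbol) (x : nat -> symbol).

Fixpoint nonzero_words (r : nat) : seq (seq symbol) :=
  if r is r'.+1 then
    [seq lift ord0 a :: u | a <- enum 'I_m.+2, u <- nonzero_words r']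
  else [:: [::]].

Lemma size_nonzero_words r : size (nonzero_words r) = (m.+2 ^ r)%N.
Proof.
by elim: r => //= r IH; rewrite size_allpairs IH -cardE card_ord expnS.
Qed.

Lemma nonzero_words_size r u : u \in nonzero_words r -> size u = r.
Proof.
elim: r u => [|r IH] u /=; first by rewrite inE => /eqP ->.
by case/allpairsP => -[a v] /= [_ /IH <- ->].
Qed.

Lemma mem_nonzero_words x a r :
  (forall i, (i < r)%N -> x (a + i)%N != ord0) ->
  mkseq (fun i => x (a + i)%N) r \in nonzero_words r.
Proof.
elim: r a => [|r IH] a xr //=; apply/allpairsP.
have := xr 0%N isT; rewrite addn0 eq_sym => /unlift_some[b xab _].
exists (b, mkseq (fun i => x (a.+1 + i)%N) r); split=> /=.
- by rewrite mem_enum.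
- by apply: IH => i ir; rewrite addSnnS xr.
rewrite /mkseq /= addn0 -xab (iotaDl 1 0) -map_comp; congr cons.
by apply: eq_map => i /=; rewrite addnA addn1.
Qed.

(* A block is either the word [0] or a zero-free word of length [1 <= r <= N]
   followed by its [g r] compulsory zeros. *)
Fixpoint block_words (N j : nat) : seq (seq symbol) :=
  if j is j'.+1 then
    [seq ord0 :: w | w <- block_words N j'] ++
    [seq v | r <- iota 1 N,
      v <- [seq u ++ nseq (g r) ord0 ++ w |
             u <- nonzero_words r, w <- block_words N j']]
  else [:: [::]].

Lemma block_wordsS N N' j : (N <= N')%N ->
  {subset block_words N j <= block_words N' j}.
Proof.
move=> NN'; elim: j => //= j IH w; rewrite !mem_cat => /orP[|].
  by move=> /mapP[v /IH vN ->]; rewrite map_f.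
case/allpairsPdep => r [v [rN]] /allpairsP[[u w'] /= [ur w'N ->] ->].
apply/orP; right; apply/allpairsPdep; exists r, (u ++ nseq (g r) ord0 ++ w').
split=> //; first by move: rN; rewrite !mem_iota; lia.
by apply/allpairsP; exists (u, w'); split=> //; exact: IH.
Qed.

Lemma mkseqD x a b : mkseq x (a + b) = mkseq x a ++ mkseq (fun i => x (a + i)%N) b.
Proof.
by rewrite /mkseq iotaD map_cat add0n -[X in iota X b]addn0 iotaDl -map_comp.
Qed.

Lemma mkseq_zero x a n : (forall i, (i < n)%N -> x (a + i)%N = ord0) ->
  mkseq (fun i => x (a + i)%N) n = nseq n ord0.
Proof.
move=> x0; apply: (@eq_from_nth _ ord0); first by rewrite size_mkseq size_nseq.
by move=> i; rewrite size_mkseq => ni; rewrite nth_mkseq// x0// nth_nseq ni.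
Qed.

Lemma mem_block_words_zero N j x n : x 0%N = ord0 ->
  mkseq (fun i => x i.+1) n \in block_words N j ->
  mkseq x n.+1 \in block_words N j.+1.
Proof.
move=> x0 xn /=; rewrite mem_cat; apply/orP; left; apply/mapP.
exists (mkseq (fun i => x i.+1) n) => //.
by rewrite -[n.+1]add1n mkseqD /mkseq /= x0.
Qed.

Lemma mem_block_words_run N j x r n : (0 < r <= N)%N ->
  (forall i, (i < r)%N -> x i != ord0) ->
  (forall i, (i < g r)%N -> x (r + i)%N = ord0) ->
  mkseq (fun i => x (r + g r + i)%N) n \in block_words N j ->
  mkseq x (r + g r + n) \in block_words N j.+1.
Proof.
move=> rN xr xg xn /=; rewrite mem_cat; apply/orP; right.
apply/allpairsPdep; exists r, (mkseq x (r + g r + n)); split=> //.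
  by rewrite mem_iota; lia.
apply/allpairsP; exists (mkseq x r, mkseq (fun i => x (r + g r + i)%N) n).
split=> //=; first exact: (@mem_nonzero_words x 0).
by rewrite mkseqD mkseqD (mkseq_zero xg) catA.
Qed.

Lemma allowed_drop x a : allowed g x -> allowed g (fun i => x (a + i)%N).
Proof.
move=> xg p r l xr xpr lg; rewrite !addnA; apply: xg => [i ir||//].
  by rewrite -addnA xr.
by rewrite -addnA addnA -!addnA.
Qed.

Lemma allowed_run x r : allowed g x -> (forall i, (i < r)%N -> x i != ord0) ->
  x r = ord0 -> forall i, (i < g r)%N -> x (r + i)%N = ord0.
Proof. by move=> xg xr xr0 i; apply: (xg 0%N). Qed.

(** Blocks are peeled off one after another: an initial 0, or the run before the first 0 with its
    compulsory zeros; what remains is again allowed and meets 0 infinitely often. Every block has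
    positive length, whence [j <= n]. The bound [N] on the runs depends on [x]. *)
Lemma prefix_block_words j x : allowed g x ->
  (forall n, exists2 k, (n <= k)%N & x k = ord0) ->
  exists N n, (j <= n)%N /\ mkseq x n \in block_words N j.
Proof.
elim: j x => [|j IH] x xg x0; first by exists 0%N, 0%N.
have IHd a : (0 < a)%N -> exists N n, (j < a + n)%N /\
    mkseq (fun i => x (a + i)%N) n \in block_words N j.
  move=> a0; have [||N [n [jn nN]]] := IH (fun i => x (a + i)%N).
  - exact: allowed_drop.
  - move=> n; have [k nk xk] := x0 (a + n)%N.
    by exists (k - a)%N; [lia|rewrite subnKC//; lia].
  by exists N, n; split=> //; lia.
have ex : exists k, x k == ord0 by have [k _ /eqP] := x0 0%N; exists k.
case: (ex_minnP ex) => -[/eqP xr _|r /eqP xr rmin].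
  have [N [n [jn nN]]] := IHd 1%N isT.
  by exists N, n.+1; split=> //; exact: mem_block_words_zero.
have xnz i : (i < r.+1)%N -> x i != ord0.
  by rewrite ltnNge; apply: contra => /rmin.
have [|N [n [jn nN]]] := IHd (r.+1 + g r.+1)%N; first by rewrite addSn.
exists (maxn r.+1 N), (r.+1 + g r.+1 + n)%N; split=> //.
apply: mem_block_words_run => //; [by rewrite leq_max leqnn|
  exact: allowed_run|].
by apply: block_wordsS nN; rewrite leq_max leqnn orbT.
Qed.

Definition block_words_upto n := [seq w | j <- iota 0 n.+1, w <- block_words n j].

(** Complete blocks are peeled off until either no 0 is left before [n] or the compulsory zeros of
    the next block reach beyond [n]. The remainder is then a zero-free run followed by zeros, either
    of which may be empty. *)
Lemma prefix_decomposition n x : allowed g x ->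
  exists k r, [/\ (k + r <= n)%N, mkseq x k \in block_words_upto n,
    forall i, (i < r)%N -> x (k + i)%N != ord0 &
    forall i, (k + r <= i < n)%N -> x i = ord0].
Proof.
move=> xg.
suff [k [r [j [kr jk xk xr xn]]]] : exists k r j, [/\ (k + r <= n)%N, (j <= k)%N,
    mkseq x k \in block_words n j, forall i, (i < r)%N -> x (k + i)%N != ord0 &
    forall i, (k + r <= i < n)%N -> x i = ord0].
  exists k, r; split=> //; apply/allpairsPdep; exists j, (mkseq x k); split=> //.
  by rewrite mem_iota; lia.
elim/ltn_ind: n x xg => n IH x xg.
have IHd a : (0 < a <= n)%N -> exists k r j, [/\ (a + k + r <= n)%N, (j <= k)%N,
    mkseq (fun i => x (a + i)%N) k \in block_words n j,
    forall i, (i < r)%N -> x (a + k + i)%N != ord0 &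
    forall i, (a + k + r <= i < n)%N -> x i = ord0].
  move=> an; have [|k [r [j [kr jk xk xr xn]]]] :=
    IH (n - a)%N _ _ (allowed_drop (a := a) xg); first by lia.
  exists k, r, j; split=> //.
  - by lia.
  - by apply: block_wordsS xk; exact: leq_subr.
  - by move=> i ir; rewrite -addnA xr.
  - move=> i ir; have := xn (i - a)%N; rewrite subnKC; [apply; lia|lia].
case: (pselect (exists k, (k < n)%N && (x k == ord0))) => [ex|nex]; last first.
  exists 0%N, n, 0%N; split=> // i; last by lia.
  by move=> ir; apply/eqP => xi; apply: nex; exists i; rewrite ir; exact/eqP.
case: (ex_minnP ex) => -[/andP[n0 /eqP xr] _|r /andP[rn /eqP xr] rmin].
  have [|k [r [j [kr jk xk xnz xn]]]] := IHd 1%N; first by lia.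
  exists k.+1, r, j.+1; split=> //; exact: mem_block_words_zero.
have xnz i : (i < r.+1)%N -> x i != ord0.
  move=> ir; apply/negP => xi; have := rmin i; rewrite xi andbT; lia.
have xg0 := allowed_run xg xnz xr.
have [gn|ng] := leqP (r.+1 + g r.+1) n; last first.
  exists 0%N, r.+1, 0%N; split=> // [|i /andP[ri ni]]; first exact: ltnW.
  rewrite add0n in ri.
  by rewrite -(subnKC ri); apply: xg0; lia.
have [|k [s [j [kr jk xk xs xn]]]] := IHd (r.+1 + g r.+1)%N.
  by rewrite gn andbT addSn.
exists (r.+1 + g r.+1 + k)%N, s, j.+1; split=> //; first by lia.
by apply: mem_block_words_run => //; lia.
Qed.

Definition prefix_words n :=
  [seq v | w <- [seq w <- block_words_upto n | (size w <= n)%N],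
    v <- [seq w ++ u ++ nseq (n - size w - r) ord0 |
           r <- iota 0 (n - size w).+1, u <- nonzero_words r]].
 
End words.

(** * Kraft sums *)

Lemma mem_prefix_words {m : nat} {g : nat -> nat} (x : nat -> 'I_m.+3) n :
  allowed g x -> mkseq x n \in @prefix_words m g n.
Proof.
move=> xg; have [k [r [krn xk xr x0]]] := prefix_decomposition n xg.
apply/allpairsPdep; exists (mkseq x k), (mkseq x n); split=> //.
  by rewrite mem_filter size_mkseq xk andbT; lia.
apply/allpairsPdep; exists r, (mkseq (fun i => x (k + i)%N) r); split.
- by rewrite mem_iota size_mkseq; lia.
- exact: mem_nonzero_words.
- have {1}-> : n = (k + (r + (n - k - r)))%N by lia.
  rewrite mkseqD size_mkseq; congr (_ ++ _).
  rewrite mkseqD; congr (_ ++ _).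
  rewrite -(@mkseq_zero _ x (k + r)%N); last by move=> i ni; apply: x0; lia.
  by apply: eq_mkseq => i /=; rewrite addnA.
Qed.

Lemma geometric_le2 (R : realType) (q : R) n : 0 <= q <= 2^-1 ->
  \sum_(j <- iota 0 n.+1) q ^+ j <= 2.
Proof.
move=> /andP[q0 q1].
(* The subtracted last term makes the induction go through for [q <= 1/2]. *)
suff : \sum_(j <- iota 0 n.+1) q ^+ j <= 2 - q ^+ n.
  by have := exprn_ge0 n q0; lra.
elim: n => [|n IH]; first by rewrite big_seq1 expr0; lra.
rewrite -addn1 iotaD big_cat big_seq1 /= add0n.
apply: le_trans (lerD IH (lexx _)) _; rewrite exprS.
by have := exprn_ge0 n q0; nra.
Qed.

Section kraft.
Context {R : realType} {m : nat} {g : nat -> nat} (rho : R).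
Local Notation M := (m.+2%:R : R).

(** The generating function of the blocks with run length at most [N]: the sum of [rho] to the power
    of the block length. *)
Definition kraft_sum N : R :=
  rho + \sum_(r <- iota 1 N) M ^+ r * rho ^+ (r + g r).

(** The weight is multiplicative under concatenation, and the list counts a word once for each of
    its decompositions into [j] blocks. *)
Lemma block_words_weight N j :
  \sum_(w <- @block_words m g N j) rho ^+ size w = kraft_sum N ^+ j.
Proof.
elim: j => [|j IH] /=; first by rewrite big_seq1.
rewrite big_cat big_map /= exprS mulrDl -IH big_distrr /=; congr (_ + _).
  by apply: eq_bigr => w _; rewrite exprS.
rewrite big_allpairs_dep /= big_distrl /=; apply: eq_bigr => r _.
rewrite big_allpairs_dep /= -natrX -size_nonzero_words.
rewrite (eq_big_seq (fun=> rho ^+ (r + g r) *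
    \sum_(w <- @block_words m g N j) rho ^+ size w)).
  by rewrite big_const_seq count_predT iter_addr_0 -[LHS]mulr_natl mulrA.
move=> u /nonzero_words_size ur; rewrite big_distrr/=; apply: eq_bigr => w _.
by rewrite !size_cat size_nseq ur addnA exprD.
Qed.

Hypotheses (rho_gt0 : 0 < rho) (rho_ge : M^-1 <= rho)
  (kraft_le : forall N, kraft_sum N <= 2^-1).

Lemma kraft_sum_ge0 N : 0 <= kraft_sum N.
Proof.
rewrite addr_ge0 ?(ltW rho_gt0)// sumr_ge0// => r _.
by rewrite mulr_ge0 ?exprn_ge0// ltW.
Qed.

Lemma nonzero_words_sum s : \sum_(r <- iota 0 s.+1) M ^+ r <= 2 * M ^+ s.
Proof.
elim: s => [|s IH]; first by rewrite big_seq1 expr0; lra.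
rewrite -addn1 iotaD big_cat big_seq1 /= add0n.
apply: le_trans (lerD IH (lexx _)) _; rewrite exprS.
have Ms : 0 <= M ^+ s by rewrite exprn_ge0.
have M2 : 2 <= M by rewrite ler_nat.
by nra.
Qed.

(** A block word [w] has at most [2 * M ^ (n - size w)] completions, which is at most
    [2 * M ^ n * rho ^ size w] because [rho * M >= 1]. Summing over [w] gives a geometric series in
    the Kraft sum, bounded by 2. *)
Lemma size_prefix_words n :
  (size (@prefix_words m g n))%:R <= 4 * M ^+ n.
Proof.
rewrite -sum1_size natr_sum /prefix_words big_allpairs_dep big_filter.
apply: (@le_trans _ _ (\sum_(w <- @block_words_upto m g n)
    2 * M ^+ n * rho ^+ size w)).
  rewrite big_mkcond; apply: ler_sum => w _; case: ifPn => [wn|_]; last first.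
    by rewrite mulr_ge0 ?exprn_ge0 ?(ltW rho_gt0)// mulr_ge0// exprn_ge0.
  rewrite big_allpairs_dep /= (eq_bigr (fun r => M ^+ r)); last first.
    by move=> r _; rewrite -natr_sum sum1_size size_nonzero_words natrX.
  apply: le_trans (nonzero_words_sum _) _; rewrite -mulrA ler_wpM2l//.
  rewrite -[X in _ <= M ^+ X * _](subnK wn) exprD -mulrA -exprMn.
  rewrite ler_peMr ?exprn_ge0// exprn_ege1//.
  by rewrite -(@ler_pM2l _ M^-1) ?invr_gt0// mulKf// mulr1.
rewrite -big_distrr /= big_allpairs_dep /=.
rewrite (eq_bigr (fun j => kraft_sum n ^+ j)); last first.
  by move=> j _; exact: block_words_weight.
have := @geometric_le2 _ (kraft_sum n) n; rewrite kraft_sum_ge0 kraft_le => /(_ isT); 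
  have := exprn_ge0 n (ler0n R m.+2).
by nra.
Qed.

End kraft.

(** * Entropy *)

Section bowen_generalities.
Context {R : realType} {X : metricType R} (f : X -> X).
Implicit Types (F : set X) (t eps : R).

Lemma bowen_outer_at_ge0 F t N eps : (0 <= bowen_outer_at f F t N eps)%E.
Proof.
apply: le_ereal_inf_tmp => _ [D [c [k [_ _ ->]]]].
by apply: esum_ge0 => i _; rewrite lee_fin expR_ge0.
Qed.

Lemma bowen_outer_at_nondecreasing F t eps :
  {homo (fun N => bowen_outer_at f F t N eps) :
    N N' / (N <= N')%N >-> (N <= N')%E}.
Proof.
move=> N N' NN'; apply: ereal_inf_le_tmp => s [D [c [k [DF Fc ->]]]].
exists D, c, k; split=> // i /DF[Fi Ni]; split=> //.
exact: leq_trans NN' Ni.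
Qed.

Lemma bowen_outer_eq0 F t eps (v : nat -> R) :
  (forall N, (bowen_outer_at f F t N eps <= (v N)%:E)%E) ->
  v @ \oo --> 0 -> bowen_outer f F t eps = 0%E.
Proof.
move=> Fv v0; apply: cvg_lim => //.
apply: (@squeeze_cvge _ _ _ _ (fun=> 0%E) _ (fun N => (v N)%:E)).
- by near=> N; rewrite bowen_outer_at_ge0 Fv.
- exact: cvg_cst.
- by apply: cvg_EFin; [near=> N|].
Unshelve. all: by end_near. Qed.

Lemma bowen_outer_ge F t eps (a : \bar R) :
  (forall N, (a <= bowen_outer_at f F t N eps)%E) ->
  (a <= bowen_outer f F t eps)%E.
Proof.
move=> aF; apply: lime_ge; last by near=> N.
exact/ereal_nondecreasing_is_cvgn/bowen_outer_at_nondecreasing.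
Unshelve. all: by end_near. Qed.

Lemma bowen_entropy_scale_le F eps t : 0 <= t -> bowen_outer f F t eps = 0%E ->
  (bowen_entropy_scale f F eps <= t%:E)%E.
Proof. by move=> t0 Ft; apply: ereal_inf_lbound; exists t. Qed.

(** A cover at a smaller scale is also one at a larger scale. This monotonicity provides the limit
    as the scale tends to 0. *)
Lemma bowen_entropy_scale_nonincreasing F :
  {homo bowen_entropy_scale f F : e e' / e <= e' >-> (e' <= e)%E}.
Proof.
move=> e e' ee'; apply: ereal_inf_le_tmp => _ [t [t0 Ft] <-]; exists t => //.
split=> //; apply/eqP; rewrite eq_le; apply/andP; split; last first.
  by apply: bowen_outer_ge => N; exact: bowen_outer_at_ge0.
rewrite -Ft; apply: lee_lim.
- exact/ereal_nondecreasing_is_cvgn/bowen_outer_at_nondecreasing.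
- exact/ereal_nondecreasing_is_cvgn/bowen_outer_at_nondecreasing.
near=> N; apply: ereal_inf_le_tmp => s [D [c [k [DF Fc ->]]]].
exists D, c, k; split=> // x /Fc[i Di xi]; exists i => //.
exact: lt_le_trans xi ee'.
Unshelve. all: by end_near. Qed.

Lemma bowen_entropy_le F (h : \bar R) :
  (forall eps, 0 < eps -> (bowen_entropy_scale f F eps <= h)%E) ->
  (bowen_entropy f F <= h)%E.
Proof.
move=> Fh; apply: lime_le; last by near=> eps; apply: Fh.
apply: nonincreasing_at_right_is_cvge; near=> eps => e e' _ _.
exact: bowen_entropy_scale_nonincreasing.
Unshelve. all: by end_near. Qed.

Lemma bowen_entropy_eq F (h : \bar R) :
  (forall eps, 0 < eps < 1 -> bowen_entropy_scale f F eps = h) ->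
  bowen_entropy f F = h.
Proof.
move=> Fh; apply: lim_near_cst; first exact: ereal_hausdorff.
near=> eps; apply: Fh; exact/andP.
Unshelve. all: by end_near. Qed.

End bowen_generalities.

(** * Upper bounds from counting words, and the topological entropy *)

Section upper_bounds.
Context {R : realType} {m : nat} {g : nat -> nat}.
Local Notation X := (gap_shift R m g).
Local Notation M := (m.+2%:R : R).
Local Notation f := (@shift R m g).

Lemma eq_mkseq_agree (x y : X) n :
  mkseq (sval x) n = mkseq (sval y) n <-> agree n x y.
Proof.
split=> [xy i ni|xy]; first by rewrite -(nth_mkseq ord0 (sval x) ni) xy nth_mkseq.
apply: (@eq_from_nth _ ord0); rewrite ?size_mkseq// => i ni.
by rewrite !nth_mkseq// xy.
Qed.

Lemma bowen_dist_lt (eps : R) n (x y : X) : 0 < eps ->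
  agree (n + depth eps) x y -> bowen_dist f n x y < eps.
Proof.
move=> e0 xy; apply: bigmax_lt => // i _; apply: agree_mdist_lt => // j jL.
by rewrite !iter_shift xy//; have := ltn_ord i; lia.
Qed.

Lemma bowen_dist_agree n (x y : X) : bowen_dist f n x y < 1 -> agree n x y.
Proof.
move=> /bigmax_ltP[_ xy] i ni; have := xy (Ordinal ni) isT.
rewrite -[X in _ < X]invr1 => /(mdist_lt _ _ 0)/(_ 0%N isT).
by rewrite !iter_shift addn0.
Qed.

(** A family of words containing a prefix of every point of [F] yields a cover: points with the
    common prefix [w] lie in one Bowen ball of length [size w - depth eps]. The infinite sum is
    controlled through its finite subsums. *)
Lemma cover_outer_le (F : set X) (t : R) N (eps B : R) (W : set (seq 'I_m.+3)) :
  0 < eps ->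
  (forall w, W w -> (N + depth eps <= size w)%N) ->
  (forall x, F x -> exists n, W (mkseq (sval x) n)) ->
  (forall s, uniq s -> (forall w, w \in s -> W w) ->
    \sum_(w <- s) expR (- (t * (size w - depth eps)%N%:R)) <= B) ->
  (bowen_outer_at f F t N eps <= B%:E)%E.
Proof.
move=> e0 Wsize FW sumB.
(* Centres must lie in [F], so only words realised as prefixes of points of [F] are kept; [pickle]
   then turns them into natural indices. *)
pose V := [set w | W w /\ exists2 x, F x & w = mkseq (sval x) (size w)].
have /choice[p pP] w : exists x : X, V w -> F x /\ w = mkseq (sval x) (size w).
  have [[_ [x Fx wx]]|nVw] := pselect (V w); first by exists x.
  by exists (@zero_point R m g).
pose word (k : nat) : seq 'I_m.+3 := odflt [::] (choice.unpickle k).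
have wordK w : word (choice.pickle w) = w by rewrite /word choice.pickleK.
apply: ge_ereal_inf; exists (\esum_(k in choice.pickle @` V)
    (expR (- (t * (size (word k) - depth eps)%N%:R)))%:E).
  exists (choice.pickle @` V), (p \o word), (fun k => size (word k) - depth eps)%N.
  split=> // [_ [w Vw <-]|x Fx].
    rewrite /= wordK; split; first by have [] := pP _ Vw.
    by have := Wsize _ Vw.1; lia.
  have [n Wx] := FW x Fx; set w := mkseq (sval x) n in Wx.
  have wx : w = mkseq (sval x) (size w) by rewrite size_mkseq.
  have Vw : V w by split=> //; exists x.
  exists (choice.pickle w); first by exists w.
  rewrite /= wordK; apply: bowen_dist_lt => //; rewrite subnK; last first.
    by have := Wsize _ Wx; lia.
  by have [_ pw] := pP _ Vw; apply/eq_mkseq_agree; rewrite -pw.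
rewrite (@reindex_esum _ _ _ V _ choice.pickle); last first.
  split=> [w Vw|v w _ _|_ [w Vw <-]]; [by exists w| |by exists w].
  exact: (pcan_inj choice.pickleK).
apply: ge_ereal_sup => _ [A [finA AV] <-].
rewrite fsbig_finite// sumEFin lee_fin.
under eq_bigr do rewrite wordK.
apply: sumB => [|w]; first exact: fset_uniq.
by rewrite in_fset_set// inE => /AV[].
Qed.

Section kraft_bound.
Variables (rho : R).
Hypotheses (rho_gt0 : 0 < rho)
  (kraft_le : forall N, @kraft_sum R m g rho N <= 2^-1).

Lemma sum_uniq_le (T : eqType) (s l : seq T) (F : T -> R) :
  (forall x, 0 <= F x) -> uniq s -> {subset s <= l} ->
  \sum_(x <- s) F x <= \sum_(x <- l) F x.
Proof.
move=> F0; elim: s l => [|x s IH] l /=; first by rewrite big_nil sumr_ge0.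
move=> /andP[xs us] sl; have xl : x \in l by rewrite sl ?mem_head.
rewrite (perm_big _ (perm_to_rem xl)) !big_cons lerD2l; apply: IH => // y ys.
by apply: rem_mem; [apply: contraNneq xs => <-|rewrite sl// inE ys orbT].
Qed.

Lemma block_words_size N j w : w \in @block_words m g N j -> (j <= size w)%N.
Proof.
elim: j w => //= j IH w; rewrite mem_cat => /orP[/mapP[v /IH jv ->]//|].
case/allpairsPdep => r [v [rN /allpairsP[[u w'] /= [ur /IH jw' ->]] ->]].
rewrite !size_cat (nonzero_words_size ur); move: rN; rewrite mem_iota.
by lia.
Qed.

(** The covering family is a union over all [N], but a finite part of it lies in a single list, to
    which the Kraft bound applies. *)
Lemma block_words_common j (s : seq (seq 'I_m.+3)) :
  (forall w, w \in s -> exists N, w \in @block_words m g N j) ->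
  exists N, {subset s <= @block_words m g N j}.
Proof.
elim: s => [|w s IH] sN; first by exists 0%N.
have [N1 wN] := sN w (mem_head _ _).
have [v vs|N2 sN2] := IH; first by apply: sN; rewrite inE vs orbT.
exists (maxn N1 N2) => v; rewrite inE => /predU1P[->|/sN2].
  by apply: block_wordsS wN; exact: leq_maxl.
by apply: block_wordsS; exact: leq_maxr.
Qed.

(** At the exponent [- ln rho] a word of length [n] has weight [rho ^ n], up to the factor
    [rho ^- L]. The words made of [N + L] blocks cover [F] and weigh at most [2 ^- (N + L)] in
    total. *)
Lemma recurrent_zero_outer (F : set X) (eps : R) : 0 < eps ->
  (forall x, F x -> forall n, exists2 k, (n <= k)%N & sval x k = ord0) ->
  bowen_outer f F (- ln rho) eps = 0%E.
Proof.
move=> e0 Fzero; set L := depth eps.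
have q0 N : 0 <= @kraft_sum R m g rho N by exact: kraft_sum_ge0.
apply: (@bowen_outer_eq0 _ _ _ _ _ _ (geometric (rho ^- L * 2^-1 ^+ L) 2^-1)).
  move=> N; apply: (@cover_outer_le _ _ _ _ _
    [set w | exists N', w \in @block_words m g N' (N + L)]) => //.
  - by move=> w [N' /block_words_size].
  - move=> x /Fzero xz.
    have [N' [n [_ nN']]] := prefix_block_words (N + L) (svalP x) xz.
    by exists n, N'.
  move=> s us sW; have [N' sN'] := block_words_common sW.
  apply: (@le_trans _ _ (\sum_(w <- s) rho ^- L * rho ^+ size w)).
    rewrite !big_seq; apply: ler_sum => w /sN'/block_words_size Lw.
    have {2}-> : (size w = L + (size w - L))%N by lia.
    rewrite exprD mulKf ?expf_neq0 ?gt_eqF// -mulNr opprK mulrC expRM_natl.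
    by rewrite lnK.
  rewrite -big_distrr /= -mulrA ler_wpM2l ?invr_ge0 ?exprn_ge0 ?(ltW rho_gt0)//.
  rewrite -exprD addnC.
  apply: le_trans (@sum_uniq_le _ _ _ _ _ us sN') _.
    by move=> w; rewrite exprn_ge0// ltW.
  by rewrite block_words_weight lerXn2r ?nnegrE// invr_ge0.
by apply: cvg_geometric; rewrite ger0_norm ?invr_ge0// invf_lt1 ?ltr1n.
Qed.

Lemma rho_lt1 : rho < 1.
Proof.
have := kraft_le 0; rewrite /kraft_sum big_nil addr0 => /le_lt_trans; apply.
by rewrite invf_lt1 ?ltr1n.
Qed.

Lemma recurrent_zero_entropy (F : set X) :
  (forall x, F x -> forall n, exists2 k, (n <= k)%N & sval x k = ord0) ->
  (bowen_entropy f F <= (- ln rho)%:E)%E.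
Proof.
move=> Fzero; apply: bowen_entropy_le => eps e0; apply: bowen_entropy_scale_le.
  by rewrite oppr_ge0 ltW// ln_lt0// rho_gt0 rho_lt1.
exact: recurrent_zero_outer.
Qed.

Hypothesis rho_ge : M^-1 <= rho.

(** At most [4 * M ^ (N + L)] prefixes of length [N + L] occur, each of weight [expR (- t) ^ N], and
    [M * expR (- t) < 1]. *)
Lemma full_outer (F : set X) (eps t : R) : 0 < eps -> ln M < t ->
  bowen_outer f F t eps = 0%E.
Proof.
move=> e0 Mt; set L := depth eps.
apply: (@bowen_outer_eq0 _ _ _ _ _ _ (geometric (4 * M ^+ L) (M * expR (- t)))).
  move=> N; apply: (@cover_outer_le _ _ _ _ _
    [set w | size w = (N + L)%N /\ w \in @prefix_words m g (N + L)]) => //.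
  - by move=> w [->].
  - move=> x _; exists (N + L)%N; split; first by rewrite size_mkseq.
    exact/mem_prefix_words/svalP.
  move=> s us sW; rewrite (eq_big_seq (fun=> expR (- t) ^+ N)); last first.
    by move=> w /sW[-> _]; rewrite addnK -mulNr mulrC expRM_natl.
  rewrite big_const_seq count_predT iter_addr_0 -[leLHS]mulr_natl /geometric /=.
  rewrite exprMn mulrA ler_wpM2r ?exprn_ge0 ?expR_ge0//.
  rewrite -mulrA -exprD addnC.
  apply: le_trans (size_prefix_words rho_gt0 rho_ge kraft_le _).
  by rewrite ler_nat uniq_leq_size// => w /sW[].
apply: cvg_geometric; rewrite ger0_norm ?mulr_ge0 ?expR_ge0//.
by rewrite expRN ltr_pdivrMr ?expR_gt0// mul1r -[ltLHS]lnK ?posrE// ltr_expR.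
Qed.

Lemma full_entropy_scale (F : set X) (eps : R) : 0 < eps ->
  (bowen_entropy_scale f F eps <= (ln M)%:E)%E.
Proof.
move=> e0; apply/lee_addgt0Pr => d d0; rewrite -EFinD; apply: bowen_entropy_scale_le.
  by rewrite addr_ge0 ?(ltW d0)// ln_ge0// ler1n.
by apply: full_outer; rewrite // ltrDl.
Qed.

Lemma sep_number_le n (eps : R) : 0 < eps ->
  (sep_number f n eps <= (4 * M ^+ (n + depth eps))%:E)%E.
Proof.
move=> e0; apply: ge_ereal_sup => _ [E sepE <-]; rewrite lee_fin.
apply: le_trans (size_prefix_words rho_gt0 rho_ge kraft_le _).
rewrite ler_nat -(size_map (fun x : X => mkseq (sval x) (n + depth eps)) E).
apply: uniq_leq_size; last first.
  by move=> _ /mapP[x _ ->]; exact/mem_prefix_words/svalP.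
rewrite map_inj_in_uniq ?fset_uniq// => x y xE yE /eq_mkseq_agree xy.
apply/eqP; apply/negPn/negP => /(sepE _ _ xE yE).
by rewrite ltNge ltW// bowen_dist_lt.
Qed.

(** All zero-free words of length [n], continued by the largest symbol, are allowed, and two
    different ones are at Bowen distance at least 1. *)
Lemma sep_number_ge n (eps : R) : eps < 1 ->
  ((M ^+ n)%:E <= sep_number f n eps)%E.
Proof.
move=> e1.
pose sym (t : {ffun 'I_n -> 'I_m.+2}) i : 'I_m.+3 :=
  if insub i is Some j then lift ord0 (t j) else ord_max.
have symP t : allowed g (sym t).
  by apply: allowed_nonzero => i; rewrite /sym; case: insub.
pose pt t : X := exist _ _ (symP t).
have pt_agree t t' : agree n (pt t) (pt t') -> t = t'.
  move=> tt'; apply/ffunP => j; have := tt' j (ltn_ord j).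
  by rewrite /= /sym valK => /lift_inj.
apply: ereal_sup_ubound; exists [fset pt t | t in {ffun 'I_n -> 'I_m.+2}]%fset.
  move=> _ _ /imfsetP[t _ ->] /imfsetP[t' _ ->] tt'.
  apply: lt_le_trans e1 _; rewrite leNgt; apply/negP => /bowen_dist_agree.
  by move=> /pt_agree tE; move/eqP: tt'; apply; rewrite tE.
rewrite card_imfset /=; last by move=> t t' tt'; apply: pt_agree; rewrite tt'.
by rewrite -cardE card_ffun !card_ord natrX.
Qed.

Lemma htop_scaleE (eps : R) : 0 < eps < 1 -> htop_scale f eps = (ln M)%:E.
Proof.
move=> /andP[e0 e1]; set L := depth eps.
(* For positive [n] this is the logarithm of the upper bound [4 * M ^ (n + L)] divided by [n]. *)
pose u n : R := ln M + (ln 4 + L%:R * ln M) * n%:R^-1.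
have ucvg : (u n)%:E @[n --> \oo] --> (ln M)%:E.
  apply: cvg_EFin; first by near=> n.
  have : ln M + (ln 4 + L%:R * ln M) * n%:R^-1 @[n --> \oo] -->
      ln M + (ln 4 + L%:R * ln M) * 0.
    apply: cvgD; [exact: cvg_cst|apply: cvgM; first exact: cvg_cst].
    by rewrite -cvg_shiftS; exact: cvg_harmonic.
  by rewrite mulr0 addr0.
have pos n (c : \bar R) : (0 < n)%N -> ((M ^+ n)%:E <= c)%E ->
    c \in `[0%E, +oo%E].
  move=> n0 Mc; rewrite in_itv /= leey andbT; apply: le_trans Mc.
  by rewrite lee_fin exprn_ge0.
have nR n : (0 < n)%N -> (n%:R : R) != 0 by rewrite pnatr_eq0 -lt0n.
apply/eqP; rewrite eq_le; apply/andP; split.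
  have [_ <-] := cvg_limn_einf_sup ucvg; apply: le_limn_esup.
  near=> n; have n0 : (0 < n)%N by near: n; exists 1%N.
  have -> : (u n)%:E = ((n%:R^-1)%:E * lne (4 * M ^+ (n + L))%:E)%E.
    rewrite lne_EFin; last by rewrite mulr_gt0// exprn_gt0.
    rewrite lnM ?posrE ?exprn_gt0// lnXn// -EFinM; congr (_%:E).
    by rewrite -[_ *+ (n + L)%N]mulr_natl natrD /u; field; exact: nR.
  rewrite lee_pmul2l ?lte_fin ?invr_gt0 ?ltr0n// lee_lne ?sep_number_le//.
    exact/(pos n)/sep_number_ge.
  by rewrite in_itv /= leey andbT lee_fin mulr_ge0// exprn_ge0.
have [_ {1}<-] := cvg_limn_einf_sup
  (cvg_cst (ln M)%:E : (fun _ : nat => _) @ \oo --> _).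
apply: le_limn_esup; near=> n; have n0 : (0 < n)%N by near: n; exists 1%N.
have -> : (ln M)%:E = ((n%:R^-1)%:E * lne (M ^+ n)%:E)%E.
  rewrite lne_EFin ?exprn_gt0// lnXn// -EFinM; congr (_%:E).
  by rewrite -[ln M *+ n]mulr_natl mulKf// nR.
rewrite lee_pmul2l ?lte_fin ?invr_gt0 ?ltr0n// lee_lne ?sep_number_ge//.
  by rewrite (pos n).
exact/(pos n)/sep_number_ge.
Unshelve. all: by end_near. Qed.

Lemma htopE : htop f = (ln M)%:E.
Proof.
apply: lim_near_cst; first exact: ereal_hausdorff.
near=> eps; apply: htop_scaleE; exact/andP.
Unshelve. all: by end_near. Qed.

End kraft_bound.
End upper_bounds.

(** * Irregular points *)

(** A 0-1 sequence without a mean: it is constant on each interval from [2 ^ k] to [2 ^ k.+1] and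
    alternates from one to the next. *)
Definition dyadic_parity (j : nat) : bool := odd (trunc_log 2 j).

Lemma sum_dyadic_parity (R : realType) n :
  \sum_(j < 2 ^ n.+1) (dyadic_parity j)%:R =
  \sum_(j < 2 ^ n) (dyadic_parity j)%:R + 2 ^+ n * (odd n)%:R :> R.
Proof.
rewrite -!(big_mkord xpredT (fun j => (dyadic_parity j)%:R)).
rewrite (@big_cat_nat _ _ _ (2 ^ n)%N) ?leq_exp2l//=; congr (_ + _).
rewrite (eq_big_nat _ _ (F2 := fun=> (odd n)%:R)); last first.
  by move=> j jn; rewrite /dyadic_parity (trunc_log_eq _ jn).
rewrite big_const_nat iter_addr_0 expnS mul2n -addnn addnK.
by rewrite -[LHS]mulr_natl natrX.
Qed.

Lemma sum_blocks (R : realType) (F : nat -> R) n b :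
  \sum_(k < n * b) F k = \sum_(j < n) \sum_(i < b) F (j * b + i)%N.
Proof.
elim: n => [|n IH]; first by rewrite mul0n !big_ord0.
by rewrite big_ord_recr /= -IH mulSnr big_split_ord.
Qed.

Section irregular.
Context {R : realType} {X : metricType R} (f : X -> X).

(* Along the times [2 ^ n * b] the averages determine [u n], the average of the
   parities below [2 ^ n], and [2 * u n.+1 - u n] is the parity of [n]. *)
Lemma irregular_dyadic_parity (phi : X -> R) (x : X) b s : (0 < b)%N ->
  (forall n, \sum_(k < n * b) phi (iter k f x) =
    n%:R * s + \sum_(j < n) (dyadic_parity j)%:R) ->
  irregular_set f phi x.
Proof.
move=> b0 phib /cvg_ex[l xl].
have b0R : b%:R != 0 :> R by rewrite pnatr_eq0 -lt0n.
have p2 n : 2 ^+ n != 0 :> R by rewrite expf_neq0 ?pnatr_eq0.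
pose u n : R := (\sum_(j < 2 ^ n) (dyadic_parity j)%:R) / 2 ^+ n.
have cvg_sub : birkhoff_average f phi x (2 ^ n * b)%N @[n --> \oo] --> l.
  apply: cvg_comp xl => A [N _ NA]; exists N => // n /= Nn; apply: NA => /=.
  apply: leq_trans Nn _.
  exact: leq_trans (ltnW (ltn_expl n (ltnSn 1))) (leq_pmulr _ _).
have uE n : u n = b%:R * birkhoff_average f phi x (2 ^ n * b)%N - s.
  rewrite /birkhoff_average phib natrM natrX /u; field.
  by rewrite p2 b0R.
have ucvg : u @ \oo --> b%:R * l - s.
  rewrite (_ : u = fun n => b%:R * birkhoff_average f phi x (2 ^ n * b)%N - s).
    by apply: cvgB; [apply: cvgM; [exact: cvg_cst|]|exact: cvg_cst].
  exact/funext.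
pose v n : R := 2 * u n.+1 - u n.
have vE n : v n = (odd n)%:R.
  by rewrite /v /u sum_dyadic_parity exprS; field; exact: p2.
have vcvg : v @ \oo --> 2 * (b%:R * l - s) - (b%:R * l - s).
  apply: cvgB => //; apply: cvgM; first exact: cvg_cst.
  by rewrite (@cvg_shiftS _ u).
have : (v n.+1 - v n) @[n --> \oo] --> (0 : R).
  rewrite -[X in _ --> X](subrr (2 * (b%:R * l - s) - (b%:R * l - s))).
  by apply: cvgB => //; rewrite (@cvg_shiftS _ v).
move=> /cvgr0_norm_lt/(_ 1 ltr01)[N _ /(_ N (leqnn N))] /=.
rewrite !vE /=; case: (odd N) => /=.
  by rewrite sub0r normrN normr1 ltxx.
by rewrite subr0 normr1 ltxx.
Qed.

End irregular.

(** * The two observables: frequency of nonzero symbols and frequency of 1s *)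

Section observables.
Context {R : realType} {m : nat} {g : nat -> nat}.
Local Notation X := (gap_shift R m g).
Local Notation f := (@shift R m g).

Lemma continuous_symbol (P : 'I_m.+3 -> R) :
  continuous (fun x : X => P (sval x 0%N)).
Proof.
move=> x; apply: cvg_near_cst; first exact: nbhs_filter.
apply: (@nbhs_agree _ _ _ x _ 1) => y xy /=.
by rewrite xy.
Qed.

Definition symbol_one : 'I_m.+3 := lift ord0 ord0.

Definition nonzero_indicator (x : X) : R := (sval x 0%N != ord0)%:R.

Definition one_indicator (x : X) : R := (sval x 0%N == symbol_one)%:R.

(** If no zero occurs from [N] on, the average at time [n > N] is [1 + (S - N) / n], with [S] the
    sum over the first [N] times, and so converges to 1. *)
Lemma irregular_nonzero_indicator (x : X) :
  irregular_set f nonzero_indicator x ->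
  forall n, exists2 k, (n <= k)%N & sval x k = ord0.
Proof.
move=> xirr N; apply: contrapT => /forall2NP xN; apply: xirr.
have xnz k : (N <= k)%N -> sval x k != ord0.
  by move=> Nk; apply/eqP => xk; have [] := xN k.
pose S := \sum_(0 <= k < N) nonzero_indicator (iter k f x).
apply/cvg_ex; exists (1 : R).
have : 1 + (S - N%:R) * n%:R^-1 @[n --> \oo] --> 1 + (S - N%:R) * 0.
  apply: cvgD; [exact: cvg_cst|apply: cvgM; first exact: cvg_cst].
  by rewrite -cvg_shiftS; exact: cvg_harmonic.
rewrite mulr0 addr0; apply: cvg_trans; apply: near_eq_cvg; near=> n.
have Nn : (N < n)%N by near: n; exists N.+1.
rewrite /birkhoff_average.
rewrite -(big_mkord xpredT (fun k => nonzero_indicator (iter k f x))).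
rewrite (@big_cat_nat _ _ _ N) ?(ltnW Nn)//= -/S.
rewrite (eq_big_nat _ _ (F2 := fun=> 1)); last first.
  move=> k /andP[Nk _]; rewrite /nonzero_indicator iter_shift addn0.
  by rewrite xnz.
rewrite big_const_nat iter_addr_0 natrB ?(ltnW Nn)//; field.
by rewrite pnatr_eq0 -lt0n; apply: leq_ltn_trans Nn.
Unshelve. all: by end_near. Qed.

Hypotheses (g0 : g 0%N = 0%N) (g1 : (0 < g 1)%N).

Lemma nonzero_indicator_irregular : irregular_set f nonzero_indicator !=set0.
Proof.
(* Nonzero symbols occur only at multiples of [b], where [dyadic_parity] selects them. As [b >= 2],
   zero-free runs have length at most 1, and [b.-1 = g 1] leaves exactly the zeros they require. *)
pose b := (g 1).+1.
pose y i : 'I_m.+3 :=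
  if (b %| i)%N && dyadic_parity (i %/ b) then ord_max else ord0.
have yb i : y i != ord0 -> (b %| i)%N.
  by rewrite /y; case: ifPn => // /andP[].
have yP : allowed g y.
  move=> p [|[|r]] l pr _; first by rewrite g0.
    move=> lg; have := pr 0%N isT; rewrite addn0 => /yb bp.
    apply/eqP; apply: contraT => /yb; rewrite -addnA dvdn_addr// => /dvdn_leq.
    by rewrite /b; lia.
  have := pr 0%N isT; rewrite addn0 => /yb bp.
  have := pr 1%N isT => /yb; rewrite dvdn_addr// dvdn1 /b; lia.
exists (exist _ y yP); apply: (@irregular_dyadic_parity _ _ _ _ _ b 0) => // n.
rewrite mulr0 add0r (sum_blocks (fun k => nonzero_indicator (iter k f _))).
apply: eq_bigr => j _.
rewrite big_ord_recl /= big1 ?addr0 => [|i _].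
  rewrite /nonzero_indicator iter_shift !addn0 /= /y dvdn_mull// mulnK//.
  by case: dyadic_parity.
rewrite /nonzero_indicator iter_shift addn0 /= /y ifF ?eqxx//.
by rewrite dvdn_addr ?dvdn_mull// gtnNdvd//= /bump /=; have := ltn_ord i; lia.
Qed.

End observables.

(** * Lower bound for the entropy *)

Lemma nonzero_words_uniq {m : nat} r : uniq (@nonzero_words m r).
Proof.
elim: r => //= r IH; rewrite allpairs_uniq ?enum_uniq//.
move=> [a u] [b v] _ _ /eqP; rewrite eqseq_cons.
by move=> /andP[/eqP/lift_inj -> /eqP ->].
Qed.

Lemma nonzero_words_nth {m : nat} r (w : seq 'I_m.+3) i :
  w \in nonzero_words r -> (i < r)%N -> nth ord0 w i != ord0.
Proof.
elim: r w i => // r IH w [|i] /allpairsP[[a u] /= [_ ur ->]]//= ir.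
exact: IH.
Qed.

(** Pigeonhole over the [l.+1] possible numbers of occurrences. *)
Lemma equal_count_words {m : nat} l (a : 'I_m.+3) : exists s,
  (m.+2 ^ l <= l.+1 *
    size [seq w <- nonzero_words l | count_mem a w == s])%N.
Proof.
pose N s := size [seq w <- nonzero_words l | count_mem a w == s].
have [|s maxs] := @bigop.eq_bigmax 'I_l.+1 N; first by rewrite card_ord.
exists (s : nat); rewrite -/(N s) -maxs.
apply: (@leq_trans (\sum_(s < l.+1) N s)%N); last first.
  apply: (@leq_trans (\sum_(s < l.+1) \max_(s < l.+1) N s)%N).
    by apply: leq_sum => i _; exact: (@bigop.leq_bigmax 'I_l.+1 (fun j => N j) i).
  by rewrite sum_nat_const card_ord.
rewrite -size_nonzero_words -sum1_size.
under [leqRHS]eq_bigr => i _ do rewrite /N size_filter -sum1_count big_mkcond.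
rewrite exchange_big /= !big_seq; apply: leq_sum => w /nonzero_words_size wl.
have wl1 : (count_mem a w < l.+1)%N by rewrite ltnS -wl count_size.
by rewrite (bigD1 (Ordinal wl1)) //= eqxx leq_addr.
Qed.

Lemma count_mkseq (R : realType) (T : eqType) (x : nat -> T) (a : T) n :
  (count_mem a (mkseq x n))%:R = \sum_(i < n) (x i == a)%:R :> R.
Proof.
elim: n => [|n IH]; first by rewrite big_ord0.
by rewrite mkseqS -cats1 count_cat natrD IH big_ord_recr /= addn0.
Qed.

HB.instance Definition _ (R : realType) (m : nat) (g : nat -> nat) :=
  isPointed.Build (gap_shift R m g) zero_point.

Section block_set.
Context {R : realType} {m : nat} {g : nat -> nat}.
Local Notation X := (gap_shift R m g).
Local Notation f := (@shift R m g).
Variables (l s K : nat) (W : seq (seq 'I_m.+3)).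
Hypotheses (l_gt0 : (0 < l)%N) (W_uniq : uniq W) (W_size : size W = K.+1)
  (W_nonzero : {subset W <= nonzero_words l})
  (W_count : forall w, w \in W -> count_mem symbol_one w = s).
Local Notation b := l.+1.

(** All words of [W] contain [s] ones, so block [j] contains [s] plus [dyadic_parity j] of them and
    the markers alone destroy convergence. Both markers are nonzero, so every choice of words gives
    an allowed sequence. *)
Definition marker (j : nat) : 'I_m.+3 :=
  if dyadic_parity j then symbol_one else ord_max.

Definition block_set : set X := [set x | forall j,
  mkseq (fun i => sval x (j * b + i)%N) l \in W /\
  sval x (j * b + l)%N = marker j].

Lemma block_set_irregular : block_set `<=` irregular_set f one_indicator.
Proof.
move=> x Gx; apply: (@irregular_dyadic_parity _ _ _ _ _ b s%:R) => // n.
rewrite (sum_blocks (fun k => one_indicator (iter k f _))).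
rewrite (eq_bigr (fun j : 'I_n => s%:R + (dyadic_parity j)%:R)); last first.
  move=> j _; have [xW xm] := Gx j.
  rewrite big_ord_recr /= -(W_count xW) count_mkseq; congr (_ + _).
    by apply: eq_bigr => i _; rewrite /one_indicator iter_shift addn0.
  rewrite /one_indicator iter_shift addn0 xm /marker.
  by case: dyadic_parity; rewrite ?eqxx.
by rewrite big_split /= sumr_const card_ord mulr_natl.
Qed.

Lemma block_set_compact : compact block_set.
Proof.
apply: (subclosed_compact _ gap_shift_compact) => //.
rewrite -openC openE => x /= /existsNP[j nGj].
apply: (@nbhs_agree _ _ _ x _ (j * b + b)%N) => y xy Gy; apply: nGj.
have [yW ym] := Gy j; split; last by rewrite xy// addnS.
rewrite (_ : mkseq _ _ = mkseq (fun i => sval y (j * b + i)%N) l)//.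
apply: (@eq_from_nth _ ord0); rewrite ?size_mkseq// => i il.
by rewrite !nth_mkseq// xy// ltn_add2l ltnS ltnW.
Qed.

Definition block_symbols (c : nat -> 'I_K.+1) (i : nat) : 'I_m.+3 :=
  if (i %% b < l)%N then nth ord0 (nth [::] W (c (i %/ b)%N)) (i %% b)
  else marker (i %/ b).

Lemma mem_nth_W (k : 'I_K.+1) : nth [::] W k \in W.
Proof. by apply: mem_nth; rewrite W_size. Qed.

Lemma block_symbols_allowed c : allowed g (block_symbols c).
Proof.
apply: allowed_nonzero => i; rewrite /block_symbols; case: ifP => il.
  exact: nonzero_words_nth (W_nonzero (mem_nth_W _)) il.
by rewrite /marker; case: ifP.
Qed.

Definition block_point c : X := exist _ _ (@block_symbols_allowed c).

Lemma block_point_word c j :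
  mkseq (fun i => sval (block_point c) (j * b + i)%N) l = nth [::] W (c j).
Proof.
apply: (@eq_from_nth _ ord0); rewrite size_mkseq.
  by rewrite (nonzero_words_size (W_nonzero (mem_nth_W _))).
move=> i il; rewrite nth_mkseq//= /block_symbols modnMDl divnMDl//.
by rewrite modn_small ?divn_small ?addn0 ?il//; exact: ltnW.
Qed.

Lemma block_point_mem c : block_set (block_point c).
Proof.
move=> j; rewrite block_point_word mem_nth_W; split=> //=.
by rewrite /block_symbols modnMDl divnMDl// modn_small// divn_small// ltnn addn0.
Qed.

Lemma block_point_inj c c' n : agree n (block_point c) (block_point c') ->
  forall j, (j < n %/ b)%N -> c j = c' j.
Proof.
move=> cc' j jn; apply: val_inj; apply/eqP.
rewrite -(nth_uniq [::] _ _ W_uniq) ?W_size ?ltn_ord// -!block_point_word.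
apply/eqP; apply: (@eq_from_nth _ ord0); rewrite ?size_mkseq// => i il.
rewrite !nth_mkseq// cc'//; apply: leq_trans (leq_trunc_div n b).
have : (j.+1 * b <= n %/ b * b)%N by rewrite leq_mul2r jn orbT.
by rewrite mulSn; lia.
Qed.

(** Agreement with [y] on [n] symbols fixes the choices in the [n %/ b] complete blocks, so
    restriction to the remaining indices is injective. *)
Lemma block_cover_card (y : X) n J : (n <= J)%N ->
  (#|[set t : {ffun 'I_J -> 'I_K.+1} |
      `[< agree n y (block_point (fun j => oapp t ord0 (insub j))) >]]%SET|
    <= K.+1 ^ (J - n %/ b))%N.
Proof.
move=> nJ; set A := [set t | _]%SET; set q := (n %/ b)%N.
have qJ : (q <= J)%N by apply: leq_trans nJ; exact: leq_div.
pose r (t : {ffun 'I_J -> 'I_K.+1}) : {ffun 'I_(J - q) -> 'I_K.+1} :=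
  [ffun j : 'I_(J - q) => oapp t ord0 (insub (q + j)%N)].
have rinj : {in A &, injective r}.
  move=> t t'; rewrite !finset.in_set => /asboolP yt /asboolP yt' rtt'.
  apply/ffunP => j; have [jq|qj] := ltnP j q.
    have := @block_point_inj (fun j => oapp t ord0 (insub j))
      (fun j => oapp t' ord0 (insub j)) n _ j jq.
    by rewrite !valK /=; apply => i iq; rewrite -(yt i)// -(yt' i).
  have jJ : (j - q < J - q)%N by have := ltn_ord j; lia.
  have := congr1 (fun u : {ffun _ -> _} => u (Ordinal jJ)) rtt'.
  by rewrite !ffunE /= subnKC// valK.
rewrite -(card_in_imset rinj) (leq_trans (max_card _))//.
by rewrite card_ffun !card_ord.
Qed.

(* By compactness the cover may be taken finite; among the points coded by
   [K.+1 ^ J] choices of words, a cylinder of length [n <= J] contains at most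
   [K.+1 ^ (J - n %/ b)]. *)
Lemma block_set_outer (F : set X) (t eps : R) N : block_set `<=` F -> 0 <= t ->
  t * b%:R <= ln K.+1%:R -> eps < 1 ->
  ((K.+1%:R^-1)%:E <= bowen_outer_at f F t N eps)%E.
Proof.
move=> GF t0 tK e1; apply: le_ereal_inf_tmp => _ [D [c [k [_ Fc ->]]]].
pose U i : set X := [set y | agree (k i) (c i) y].
have Uopen i : D i -> open (U i).
  move=> _; rewrite openE => y yi; apply: (@nbhs_agree _ _ _ y _ (k i)) => z yz j jk.
  by rewrite yi// yz.
have GU : block_set `<=` cover D U.
  move=> x /GF/Fc[i Di xi]; exists i => //; apply: bowen_dist_agree.
  exact: lt_trans e1.
have : compact block_set by exact: block_set_compact.
rewrite compact_cover => /(_ _ _ _ Uopen GU)[D' D'D GD'].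
apply: esum_ge; exists [set` D'].
  by split=> [|i /= /D'D]; [exact: finite_fset|rewrite inE].
rewrite (fsbig_finite _ _ (finite_fset _)) set_fsetK.
rewrite sumEFin lee_fin.
pose J := (\max_(i <- D') k i)%N.
have kJ i : i \in D' -> (k i <= J)%N by move=> iD; exact: leq_bigmax_seq.
pose A i := [set t : {ffun 'I_J -> 'I_K.+1} |
  `[< agree (k i) (c i) (block_point (fun j => oapp t ord0 (insub j))) >]]%SET.
have count : (K.+1 ^ J <= \sum_(i <- D') K.+1 ^ (J - k i %/ b))%N.
  apply: (@leq_trans (\sum_(i <- D') #|A i|)%N); last first.
    by rewrite !big_seq; apply: leq_sum => i /kJ; exact: block_cover_card.
  have -> : (K.+1 ^ J = \sum_(t : {ffun 'I_J -> 'I_K.+1}) 1)%N.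
    by rewrite sum1_card card_ffun !card_ord.
  under eq_bigr do rewrite -sum1_card big_mkcond.
  rewrite exchange_big /=; apply: leq_sum => u _.
  have [i iD' ui] := GD' _ (block_point_mem (fun j => oapp u ord0 (insub j))).
  rewrite (big_rem i)//= ifT ?leq_addr//.
  by rewrite finset.in_set; exact/asboolP.
have K0 : 0 < K.+1%:R :> R by rewrite ltr0n.
have Kn0 := lt0r_neq0 K0.
(* After multiplication by [K.+1 ^ J.+1] the sums are compared term by term. The extra power of
   [K.+1] pays for the incomplete last block: [k i] is less than [(k i %/ b).+1 * b]. *)
rewrite -(ler_pM2l (exprn_gt0 J.+1 K0)) {1}exprS mulrAC divff// mul1r.
apply: (@le_trans _ _ (\sum_(i <- D') K.+1%:R ^+ (J - k i %/ b))).
  by under eq_bigr do rewrite -natrX; rewrite -natr_sum -natrX ler_nat.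
rewrite big_distrr /= !big_seq; apply: ler_sum => i /kJ kiJ.
have qJ : (k i %/ b <= J)%N by apply: leq_trans kiJ; exact: leq_div.
have -> : J.+1 = ((J - k i %/ b) + (k i %/ b).+1)%N by rewrite addnS subnK.
rewrite exprD -mulrA ler_peMr ?exprn_ge0//.
rewrite expRN -[X in X ^+ _]lnK ?posrE// -expRM_natl -expRN -expRD.
rewrite -[leLHS]expR0 ler_expR.
rewrite subr_ge0; apply: (@le_trans _ _ (t * ((k i %/ b).+1 * b)%N%:R)).
  rewrite ler_wpM2l// ler_nat; exact/ltnW/ltn_ceil.
by rewrite natrM mulrCA ler_wpM2l.
Qed.

Lemma block_set_scale (F : set X) (eps : R) : block_set `<=` F -> eps < 1 ->
  ((ln K.+1%:R / b%:R)%:E <= bowen_entropy_scale f F eps)%E.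
Proof.
move=> GF e1; apply: le_ereal_inf_tmp => _ [t [t0 Ft] <-].
rewrite lee_fin leNgt; apply/negP => tK.
have : ((K.+1%:R^-1)%:E <= bowen_outer f F t eps)%E.
  apply: bowen_outer_ge => N; apply: block_set_outer => //.
  by rewrite -ler_pdivlMr ?ltr0n// ltW.
by rewrite Ft lee_fin leNgt invr_gt0 ltr0n.
Qed.

End block_set.

(** * Full entropy of the points with irregular frequency of 1s *)

Section one_irregular.
Context {R : realType} {m : nat} {g : nat -> nat}.
Local Notation X := (gap_shift R m g).
Local Notation f := (@shift R m g).
Local Notation M := (m.+2%:R : R).

Lemma equal_count_block_set l : (0 < l)%N -> exists (G : set X) (K : nat),
  [/\ G `<=` irregular_set f one_indicator, G !=set0,
    M ^+ l <= l.+1%:R * K%:R, (0 < K)%N &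
    forall F (eps : R), G `<=` F -> eps < 1 ->
      ((ln K%:R / l.+1%:R)%:E <= bowen_entropy_scale f F eps)%E].
Proof.
move=> l0; have [s] := @equal_count_words m l symbol_one.
set W := [seq w <- _ | _] => MW.
have Wu : uniq W by rewrite filter_uniq// nonzero_words_uniq.
have Wn : {subset W <= nonzero_words l} by move=> w; rewrite mem_filter => /andP[].
have Wc w : w \in W -> count_mem symbol_one w = s.
  by rewrite mem_filter => /andP[/eqP].
have : (0 < size W)%N.
  rewrite lt0n; apply: contraTneq MW => ->; rewrite muln0 leqn0 -lt0n.
  by rewrite expn_gt0.
case WK : (size W) => [//|K] _; exists (block_set l W), K.+1; split=> //.
- exact: block_set_irregular Wc.
- by exists (block_point WK Wn (fun=> ord0)); exact: block_point_mem.
- by rewrite -natrX -natrM ler_nat -WK.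
- by move=> F eps; exact: block_set_scale.
Qed.

Lemma one_indicator_irregular : irregular_set f one_indicator !=set0.
Proof.
have [G [K [GI [x Gx] _ _ _]]] := @equal_count_block_set 1 isT.
by exists x; exact: GI.
Qed.

Lemma one_indicator_scale (F : set X) (eps : R) :
  irregular_set f one_indicator `<=` F -> eps < 1 ->
  ((ln M)%:E <= bowen_entropy_scale f F eps)%E.
Proof.
move=> IF e1; apply/lee_addgt0Pr => d d0.
have lnM0 : 0 <= ln M by rewrite ln_ge0// ler1n.
(* With [l.+1 = k ^ 2] and [ln k <= k], the loss [(ln M + ln l.+1) / l.+1] is at most
   [(ln M + 2 * k) / k ^ 2], hence at most [(ln M + 2) / k < d]. *)
pose k := (Num.truncn ((ln M + 2) / d)).+2.
have k0 : 0 < k%:R :> R by rewrite ltr0n.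
have kd : (ln M + 2) / k%:R < d.
  rewrite ltr_pdivrMr// mulrC -ltr_pdivrMr//.
  by apply: lt_trans (truncnS_gt _) _; rewrite ltr_nat.
pose l := (k ^ 2).-1; have l1 : l.+1 = (k ^ 2)%N by rewrite prednK// expn_gt0.
have l0 : (0 < l)%N by rewrite -ltnS l1 (ltn_exp2l 0) // /k.
have [G [K [GI _ MK K0 Gscale]]] := equal_count_block_set l0.
have /(_ eps) := Gscale F _ (subset_trans GI IF) => /(_ e1) lK.
apply: (@le_trans _ _ ((ln K%:R / l.+1%:R)%:E + d%:E)%E); last by rewrite leeD2r.
rewrite -EFinD lee_fin -lerBlDr.
have l10 : 0 < l.+1%:R :> R by rewrite ltr0n.
have KR : 0 < K%:R :> R by rewrite ltr0n.
have : l%:R * ln M <= ln l.+1%:R + ln K%:R.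
  rewrite -lnM ?posrE// mulr_natl -lnXn// ler_ln ?posrE ?exprn_gt0//.
  exact: mulr_gt0.
have lnl : ln l.+1%:R <= 2 * k%:R :> R.
  rewrite l1 natrX lnXn// -[_ *+ 2]mulr_natl ler_pM2l//.
  by apply: ltW; exact: ln_sublinear.
rewrite ler_pdivlMr// => lM.
have lkk : l.+1%:R = k%:R * k%:R :> R by rewrite l1 natrX expr2.
have lR : l%:R = l.+1%:R - 1 :> R by rewrite -addn1 natrD addrK.
have dl : (ln M + 2) * k%:R < d * l.+1%:R.
  by move: kd; rewrite ltr_pdivrMr// => kd; rewrite lkk mulrA ltr_pM2r.
have k1 : 1 <= k%:R :> R by rewrite ler1n.
have lnMk : ln M <= ln M * k%:R by rewrite ler_peMr.
rewrite lR in lM.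
by clear -lM lnl lnMk dl; lra.
Qed.

End one_irregular.

(** * Choice of the parameters *)

(** With [M = m.+2] and [rho = M ^ (- c)], the [r]-th term is at most [theta ^ r] for
    [theta = M ^ (- eta)], where [eta = c * (1 + K) - 1 > 0]. For large [M] both [rho] and [theta]
    are at most 1/8, and the Kraft sum is at most [rho + 2 * theta <= 3/8]. The lower bound on [rho]
    comes from [c <= 1]. *)
Lemma kraft_sum_small (R : realType) (g : nat -> nat) (c K : R) : 0 < c <= 1 ->
  1 < c * (1 + K) -> (forall r, K * r%:R <= (g r)%:R) ->
  exists m, let rho := expR (- (c * ln m.+2%:R)) in
    m.+2%:R^-1 <= rho /\ forall N, @kraft_sum R m g rho N <= 2^-1.
Proof.
move=> /andP[c0 c1] cK gK; set eta := c * (1 + K) - 1.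
have eta0 : 0 < eta by rewrite subr_gt0.
have ln8 : 0 < ln 8 :> R by rewrite ln_gt0 // ltr1n.
(* The first summand forces [rho <= 1/8], the second [theta <= 1/8]. *)
pose T := ln 8 / c + ln 8 / eta.
exists (Num.truncn (expR T)) => rho; set M := _.+2%:R in rho *.
have MT : expR T < M.
  by apply: lt_trans (truncnS_gt _) _; rewrite ltr_nat.
have M0 : 0 < M by rewrite ltr0n.
set H := ln M in rho *.
have HT : T <= H by rewrite -ler_expR lnK// ltW.
have T0 : 0 < T by rewrite addr_gt0// divr_gt0.
have small a : ln 8 <= H * a -> expR (- (H * a)) <= 8^-1.
  move=> Ha; rewrite expRN lef_pV2 ?posrE ?expR_gt0//.
  by rewrite -[leLHS]lnK ?posrE// ler_expR.
have Hle a : 0 < a -> ln 8 / a <= T -> ln 8 <= H * a.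
  by move=> a0 aT; rewrite -ler_pdivrMr// (le_trans aT).
have rho8 : rho <= 8^-1.
  rewrite /rho mulrC; apply/small/Hle => //.
  by rewrite lerDl divr_ge0// ltW.
pose theta := expR (- (H * eta)).
have theta8 : theta <= 8^-1.
  by apply/small/Hle => //; rewrite lerDr divr_ge0// ltW.
have theta0 : 0 <= theta := expR_ge0 _.
have H0 : 0 <= H by rewrite (le_trans (ltW T0)).
split.
  rewrite -[M]lnK// -expRN ler_expR lerN2 -/H.
  by rewrite ler_piMl.
move=> N; rewrite /kraft_sum.
suff : \sum_(r <- iota 1 N) M ^+ r * rho ^+ (r + g r) <= 2 * theta by lra.
apply: (@le_trans _ _ (\sum_(r <- iota 1 N) theta ^+ r)).
  apply: ler_sum => r _; rewrite -{1}[M]lnK// -!expRM_natl -expRD ler_expR -/H.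
  rewrite natrD /eta.
  have := ler_wpM2l (mulr_ge0 (ltW c0) H0) (gK r).
  by nra.
case: N => [|N]; first by rewrite big_nil mulr_ge0.
rewrite (iotaDl 1 0) big_map.
under eq_bigr do rewrite exprD expr1.
rewrite -big_distrr /= mulrC ler_wpM2r//.
by apply: geometric_le2; rewrite theta0/=; lra.
Qed.

(** For finite [tau], [g] is [tau * n] rounded up past the next integer and [K = tau], so that
    [c * (1 + K) = 1 + delta * (1 + tau)]. For infinite [tau], [c = delta], and a quadratic [g] has
    infinite rate while dominating a linear function of any prescribed slope [K]. *)
Lemma gap_rate_exists (R : realType) (tau : \bar R) (delta : R) :
  (0 < tau)%E -> 0 < delta -> (delta%:E < 1 - (1 + tau)^-1)%E ->
  exists (g : nat -> nat) (c K : R),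
  [/\ {homo g : r s / (r <= s)%N}, g 0%N = 0%N,
      forall r, (0 < r)%N -> (0 < g r)%N,
      ((g n)%:R / n%:R)%:E @[n --> \oo] --> tau &
      [/\ ((1 + tau)^-1 + delta%:E)%E = c%:E, 0 < c, c < 1,
          1 < c * (1 + K) & forall r, K * r%:R <= (g r)%:R]].
Proof.
case: tau => [tau| |] //.
- rewrite lte_fin => tau0 delta0.
  have tau1 : 0 < 1 + tau by rewrite addr_gt0.
  rewrite -EFinD inver gt_eqF// -EFinB -EFinD lte_fin => delta1.
  pose g n := if n == 0%N then 0%N else (Num.truncn (tau * n%:R)).+1.
  have gK r : tau * r%:R <= (g r)%:R.
    rewrite /g; case: eqP => [->|_]; first by rewrite mulr0.
    exact/ltW/truncnS_gt.
  exists g, ((1 + tau)^-1 + delta), tau; split.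
  + move=> r s rs; rewrite /g; case: eqP => // /eqP r0.
    rewrite ifF; last by apply/eqP => s0; move: r0 rs; rewrite s0 leqn0 => /negPf ->.
    by rewrite ltnS le_truncn// ler_wpM2l ?(ltW tau0)// ler_nat.
  + by [].
  + by move=> [].
  + apply: cvg_EFin; first by near=> n.
    apply: (@squeeze_cvgr _ _ _ _ (fun=> tau) (fun n => tau + n%:R^-1)).
    * near=> n; have n0 : (0 < n)%N by near: n; exists 1%N.
      have nR : 0 < n%:R :> R by rewrite ltr0n.
      rewrite /= ler_pdivlMr// gK/= ler_pdivrMr// mulrDl mulVf ?gt_eqF//.
      rewrite /g gtn_eqF// -natr1 lerD2r.
      by rewrite truncn_le// mulr_ge0 ?ltW.
    * exact: cvg_cst.
    * have : tau + n%:R^-1 @[n --> \oo] --> tau + 0.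
        apply: cvgD; first exact: cvg_cst.
        by rewrite -cvg_shiftS; exact: cvg_harmonic.
      by rewrite addr0.
  split=> //.
  + by rewrite addr_gt0// invr_gt0.
  + by move: delta1; lra.
  + by rewrite mulrDl mulVf ?gt_eqF// ltrDl mulr_gt0.
- move=> _ delta0; rewrite addey// invey sube0 lte_fin => delta1.
  (* The slope exceeds [1 / delta], so that [c * (1 + K) > 1] with [c = delta] and [K = k]. *)
  pose k := (Num.truncn delta^-1).+1.
  have k0 : 0 < k%:R :> R by rewrite ltr0n.
  have kd : 1 < delta * k%:R.
    by rewrite mulrC -ltr_pdivrMr// mul1r truncnS_gt.
  exists (fun n => k * n ^ 2)%N, delta, k%:R; split.
  + by move=> r s rs; rewrite leq_mul2l leq_sqr rs orbT.
  + by rewrite muln0.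
  + by move=> r r0; rewrite muln_gt0 expn_gt0 r0.
  + apply/cvgeryP/cvgryPge => A; near=> n.
    have n0 : (0 < n)%N by near: n; exists 1%N.
    have nR : 0 < n%:R :> R by rewrite ltr0n.
    rewrite natrM natrX expr2 mulrA mulfK ?gt_eqF//.
    apply: (@le_trans _ _ n%:R); last by rewrite ler_peMl ?ler1n// ltW.
    by near: n; exact: nbhs_infty_ger.
  split=> //.
  + by rewrite add0e.
  + by rewrite mulrDr mulr1; lra.
  + by move=> r; rewrite natrM ler_wpM2l// ler_nat; nia.
Unshelve. all: by end_near. Qed.

(* In the extended reals, (1 + +oo)^-1 = 0. *)
Theorem theorem4 (R : realType) (tau : \bar R) (delta : R)
    (tau_gt0 : (0 < tau)%E) (delta_gt0 : 0 < delta)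
    (delta_lt : (delta%:E < 1 - (1 + tau)^-1)%E) :
  exists (X : metricType R) (f : X -> X) (M : nat -> R -> nat),
    [/\ is_tds f,
        nonuniform_tau_specification f tau,
        gap_function f M &
    [/\ \forall eps \near 0^'+, gap_ratio M eps @ \oo --> tau,
        (exists psi : X -> R,
           irregular_observables f psi /\
           bowen_entropy f (irregular_set f psi) = htop f) /\
        bowen_entropy f (IR f) = htop f &
        (exists phi : X -> R,
           [/\ irregular_observables f phi,
               (bowen_entropy f (irregular_set f phi)
                  <= ((1 + tau)^-1 + delta%:E) * htop f)%E &
               (((1 + tau)^-1 + delta%:E) * htop f < htop f)%E]) /\
        ((bowen_entropy f (CI f) <= ((1 + tau)^-1 + delta%:E) * htop f)%E /\
         (((1 + tau)^-1 + delta%:E) * htop f < htop f)%E)]].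
Proof.
have [g [c [K [g_mono g0 g_gt0 g_cvg [cE c0 c1 cK gK]]]]] :=
  gap_rate_exists tau_gt0 delta_gt0 delta_lt.
have c01 : 0 < c <= 1 by rewrite c0 ltW.
have [m [rho_ge kraft_le]] := kraft_sum_small c01 cK gK.
set rho := expR _ in rho_ge kraft_le.
have rho0 : 0 < rho := expR_gt0 _.
have M0 : 0 < m.+2%:R :> R by rewrite ltr0n.
have lnM0 : 0 < ln m.+2%:R :> R by rewrite ln_gt0// ltr1n.
pose X : metricType R := gap_shift R m g; pose f : X -> X := shift.
have htopf : htop f = (ln m.+2%:R)%:E by exact: htopE rho0 kraft_le rho_ge.
(* Quantified over all supersets, this serves both the irregular set itself and [IR f]. *)
have scaleE (F : set X) : irregular_set f one_indicator `<=` F ->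
    bowen_entropy f F = htop f.
  move=> IF; rewrite htopf; apply: bowen_entropy_eq => eps /andP[e0 e1].
  apply/eqP; rewrite eq_le; apply/andP; split; last exact: one_indicator_scale.
  exact: full_entropy_scale rho0 kraft_le rho_ge _ _ e0.
have continuous_one : continuous (@one_indicator R m g).
  exact: (@continuous_symbol R m g (fun a => (a == symbol_one)%:R)).
have phi_irr : irregular_observables f nonzero_indicator.
  split; last exact: nonzero_indicator_irregular (g_gt0 _ _).
  exact: (@continuous_symbol R m g (fun a => (a != ord0)%:R)).
(* Quantified over all subsets, this serves both the irregular set itself and [CI f]. The bound
   [c * ln m.+2] is [- ln rho] by the choice of [rho]. *)
have phi_le (F : set X) : F `<=` irregular_set f nonzero_indicator ->
    (bowen_entropy f F <= c%:E * htop f)%E.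
  move=> FI; rewrite htopf -EFinM -[c * _]opprK -[- (c * _)]expRK.
  apply: recurrent_zero_entropy rho0 kraft_le _ _ => x /FI.
  exact: irregular_nonzero_indicator.
have c_lt : (c%:E * htop f < htop f)%E.
  by rewrite htopf -EFinM lte_fin gtr_pMl.
exists X, f, (@gap R g); rewrite cE; split.
- exact: shift_is_tds.
- exact: shift_tau_specification.
- exact: gap_function_gap.
split.
- by near=> eps; exact: cvg_gap_ratio.
- split; last by apply: scaleE => x xI; exists one_indicator.
  exists one_indicator; split; last exact: scaleE.
  by split=> //; exact: one_indicator_irregular.
- split; first by exists nonzero_indicator; split=> //; exact: phi_le.
  by split=> //; apply: phi_le => x; apply.
Unshelve. all: by end_near. Qed.
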